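(* Let $(R,\mathfrak m)$ be a regular local ring of dimension $d>0$ and let $\mathfrak p$ be a prime ideal of height $d-1$ such that $R/\mathfrak p$ is not complete. Then $\operatorname{pd}_R(E_R(R/\mathfrak p))=d$.
   Context: Complete means complete in the topology defined by the maximal ideal. $E_R(N)$ denotes the injective envelope of an $R$-module $N$, and $\operatorname{pd}_R$ denotes projective dimension. *)

(* Defs.v *)
From HB Require Import structures.
From mathcomp Require Import all_boot all_algebra.
From mathcomp Require Export generic_quotient ring_quotient.

Set Implicit Arguments.
Unset Strict Implicit.
Unset Printing Implicit Defensive.

Import GRing.Theory.
Local Open Scope ring_scope.
Local Open Scope quotient_scope.

(* Ideals are MathComp's [idealr R] (proper ideals given by a boolean
   predicate) and [prime_idealr R].  In the presence of the classical axioms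
   every proper (prime) ideal in the usual sense is of this form. *)

Section QuotientModule.
Variables (R : comNzRingType) (I : idealr R).

Definition quot_scale (a : R) (x : {ideal_quot I}) : {ideal_quot I} :=
  \pi_{ideal_quot I} a * x.

Fact quot_scaleA a b x : quot_scale a (quot_scale b x) = quot_scale (a * b) x.
Proof. by rewrite /quot_scale rmorphM mulrA. Qed.

Fact quot_scale1 : left_id 1 quot_scale.
Proof. by move=> x; rewrite /quot_scale rmorph1 mul1r. Qed.

Fact quot_scaleDr : right_distributive quot_scale +%R.
Proof. by move=> a x y; rewrite /quot_scale mulrDr. Qed.

Fact quot_scaleDl x : {morph quot_scale^~ x : a b / a + b}.
Proof. by move=> a b; rewrite /quot_scale rmorphD mulrDl. Qed.

HB.instance Definition _ := GRing.Zmodule_isLmodule.Build R {ideal_quot I}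
  quot_scaleA quot_scale1 quot_scaleDr quot_scaleDl.

End QuotientModule.

Section Ideals.
Variable R : comNzRingType.
Implicit Types (I J m : idealr R) (p : prime_idealr R).

Definition maximal_ideal m : Prop :=
  forall J, {subset m <= J} -> {subset J <= m}.

Definition local_ring m : Prop :=
  maximal_ideal m /\ forall J, maximal_ideal J -> J =i m.

Definition ideal_generated_by (s : seq R) I : Prop :=
  forall x, x \in I <-> exists c : nat -> R, x = \sum_(i < size s) c i * s`_i.

(* The unit ideal is not an [idealr], but it is always generated by 1. *)
Definition noetherian : Prop := forall I, exists s, ideal_generated_by s I.

(* P 0 < P 1 < ... < P n; the values of P beyond n are irrelevant. *)
Definition prime_chain (n : nat) (P : nat -> prime_idealr R) : Prop :=
  forall i, (i < n)%N ->
    {subset P i <= P i.+1} /\ ~ {subset P i.+1 <= P i}.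

Definition has_krull_dim (d : nat) : Prop :=
  (exists P, prime_chain d P) /\
  (forall n P, prime_chain n P -> (n <= d)%N).

Definition has_height p (h : nat) : Prop :=
  (exists2 P, prime_chain h P & P h =i p) /\
  (forall n P, prime_chain n P -> P n =i p -> (n <= h)%N).

Definition regular_local_ring m (d : nat) : Prop :=
  [/\ noetherian, local_ring m, has_krull_dim d
    & exists2 s : seq R, size s = d & ideal_generated_by s m].

End Ideals.

Arguments has_krull_dim : clear implicits.
Arguments noetherian : clear implicits.

Section AdicTopology.
Variable A : comNzRingType.
Implicit Types (I J : A -> Prop) (u : nat -> A).

Definition ideal_mul I J (x : A) : Prop :=
  exists2 s : seq (A * A),
    forall ab, ab \in s -> I ab.1 /\ J ab.2 & x = \sum_(ab <- s) ab.1 * ab.2.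

Fixpoint ideal_pow I (n : nat) : A -> Prop :=
  if n is k.+1 then ideal_mul I (ideal_pow I k) else fun=> True.

Definition adic_cauchy I u : Prop :=
  forall n, exists N, forall i j, (N <= i)%N -> (N <= j)%N ->
    ideal_pow I n (u i - u j).

Definition adic_lim I u (l : A) : Prop :=
  forall n, exists N, forall i, (N <= i)%N -> ideal_pow I n (u i - l).

(* Uniqueness of limits says that the topology is separated. *)
Definition adic_complete I : Prop :=
  forall u, adic_cauchy I u -> exists! l, adic_lim I u l.

End AdicTopology.

(* For [I] contained in the maximal ideal [m] of a local ring, this is the
   maximal ideal of the quotient by [I]. *)
Definition quot_image (R : comNzRingType) (I m : idealr R)
  (x : {ideal_quot I}) : Prop :=
  exists2 r, r \in m & x = \pi_{ideal_quot I} r.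

Section Modules.
Variable R : comNzRingType.
Implicit Types L M N E P : lmodType R.

Definition surjective_map (U V : Type) (f : U -> V) : Prop :=
  forall y, exists x, f x = y.

Definition injective_module E : Prop :=
  forall M N (i : {linear M -> N}) (f : {linear M -> E}), injective i ->
    exists g : {linear N -> E}, forall x, g (i x) = f x.

Definition projective_module P : Prop :=
  forall M N (q : {linear M -> N}) (f : {linear P -> N}), surjective_map q ->
    exists g : {linear P -> M}, forall x, q (g x) = f x.

Definition essential_mono N E (i : {linear N -> E}) : Prop :=
  injective i /\
  forall S : {pred E}, submod_closed S -> (exists2 y, y \in S & y != 0) ->
    exists x, i x \in S /\ i x != 0.

Definition is_injective_envelope N E : Prop :=
  injective_module E /\ exists i : {linear N -> E}, essential_mono i.

Definition exact_at L M N (f : {linear L -> M}) (g : {linear M -> N}) : Prop :=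
  forall y, g y = 0 <-> exists x, f x = y.

Definition projective_resolution M (P : nat -> lmodType R)
    (d : forall i, {linear P i.+1 -> P i}) (eps : {linear P 0 -> M}) : Prop :=
  [/\ forall i, projective_module (P i),
      forall i, exact_at (d i.+1) (d i),
      exact_at (d 0) eps
    & surjective_map eps].

Definition projdim_le M (n : nat) : Prop :=
  exists (P : nat -> lmodType R) (d : forall i, {linear P i.+1 -> P i})
    (eps : {linear P 0 -> M}),
    projective_resolution d eps /\ forall i, (n < i)%N -> forall x : P i, x = 0.

Definition has_projdim M (n : nat) : Prop :=
  projdim_le M n /\ forall k, projdim_le M k -> (n <= k)%N.

End Modules.

(* Main.v *)
(** Let [h = d - 1].

    Upper bound.  A regular system of parameters [y_1, ..., y_d] is a regular sequence, so
    the [d]-th syzygy of a cyclic module is regular for it and, being finitely generated,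
    free.  Filtering an arbitrary module by cyclic quotients along a well-ordering gives
    projective dimension at most [d] for all modules.

    Lower bound.  Since only [m] lies strictly above [p], [p] contains a regular sequence
    [x_1, ..., x_h], and there is [s] in [m] outside [p].  In a projective resolution of
    length at most [h], the [h]-th syzygy [Z] of [E] would be projective, and
    [Tor_h (R / (x), E)], which is the part of [E] killed by the [x_i], would embed in
    [Z / (x) Z].  The former is nonzero and [s]-divisible, as [E] is injective; the latter
    has no nonzero [s]-divisible submodule, by Krull's intersection theorem. *)
From HB Require Import structures.
Require Import Defs.
From mathcomp Require Import all_boot all_algebra.
From mathcomp Require Import finmap boolp wochoice ring.
From mathcomp Require Import monalg.

Set Implicit Arguments.
Unset Strict Implicit.
Unset Printing Implicit Defensive.

Import GRing.Theory.

(** * Submodules and ideals as predicates *)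

Section PropSubmodules.
Local Open Scope ring_scope.
Variable R : comNzRingType.

(** [E] is not finitely generated, so no minimal resolution of it is at hand, and a nonzero Tor_h
    alone does not contradict a projective [Z]. Hence the lower bound transports an infinite tower
    of elements, each being [s] times the next. The two demands on [s] serve opposite ends: outside
    [p], multiplication by [s] is injective on R/p, which the injectivity of [E] turns into division
    by [s]; inside [m], Nakayama forbids such towers in Z/(x)Z. Tor is never formed as a module. Its
    elements descend the syzygies one at a time, each connecting map of the snake lemma using up one
    term of the sequence. The same transport, with the parameters [y] and [s = 1], carries a class
    down a minimal resolution of R/m; this shows that R/(x) has positive depth for every regular
    sequence shorter than [d], which is what puts a regular sequence inside [p]. Regularity of the
    parameters is not part of the definition of a regular local ring, which only compares the number
    of generators of [m] with the dimension. Krull's principal ideal theorem, applied to chains of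
    primes, bridges this. *)

Definition submod (V : lmodType R) (B : V -> Prop) : Prop :=
  B 0 /\ forall a u v, B u -> B v -> B (a *: u + v).

Definition ideal (I : R -> Prop) : Prop := @submod R^o I.

Section Closure.
Variables (V : lmodType R) (B : V -> Prop).
Hypothesis hB : submod B.

Lemma submod0 : B 0. Proof. by case: hB. Qed.

Lemma submodD u v : B u -> B v -> B (u + v).
Proof. by case: hB => _ h hu hv; have := h 1 u v hu hv; rewrite scale1r. Qed.

Lemma submodZ a u : B u -> B (a *: u).
Proof. by case: hB => h0 h hu; have := h a u 0 hu h0; rewrite addr0. Qed.

Lemma submodN u : B u -> B (- u).
Proof. by move=> hu; rewrite -scaleN1r; apply: submodZ. Qed.

Lemma submodB u v : B u -> B v -> B (u - v).
Proof. by move=> hu hv; apply: submodD => //; apply: submodN. Qed.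

Lemma submod_addr u v : B v -> B (u + v) -> B u.
Proof. by move=> hv huv; rewrite -(addrK v u); apply: submodB. Qed.

Lemma submod_subr u v : B v -> B (u - v) -> B u.
Proof. by move=> hv huv; rewrite -(subrK v u); apply: submodD. Qed.

Lemma submod_sum (I : Type) (r : seq I) (F : I -> V) :
  (forall i, B (F i)) -> B (\sum_(i <- r) F i).
Proof. by move=> h; elim/big_ind: _; [exact: submod0 | exact: submodD |]. Qed.

End Closure.

Section IdealClosure.
Variable I : R -> Prop.
Hypothesis hI : ideal I.

Lemma ideal0 : I 0. Proof. exact: (submod0 hI). Qed.
Lemma idealD u v : I u -> I v -> I (u + v). Proof. exact: (submodD hI). Qed.
Lemma idealN u : I u -> I (- u). Proof. exact: (submodN hI). Qed.
Lemma idealB u v : I u -> I v -> I (u - v). Proof. exact: (submodB hI). Qed.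
Lemma idealM a u : I u -> I (a * u). Proof. exact: (submodZ hI). Qed.
Lemma idealMl a u : I u -> I (u * a).
Proof. by rewrite mulrC; apply: idealM. Qed.
Lemma ideal_subr u v : I v -> I (u - v) -> I u. Proof. exact: (submod_subr hI). Qed.

Lemma ideal1 : I 1 -> forall r, I r.
Proof. by move=> h r; rewrite -[r]mulr1; apply: idealM. Qed.

End IdealClosure.

Lemma idealP (I : R -> Prop) : I 0 -> (forall x y, I x -> I y -> I (x + y)) ->
  (forall a x, I x -> I (a * x)) -> ideal I.
Proof. by move=> h0 hD hM; split=> // a u v hu hv; apply: hD => //; apply: hM. Qed.

Definition isprime (P : R -> Prop) : Prop :=
  [/\ ideal P, ~ P 1 & forall u v, P (u * v) -> P u \/ P v].

Lemma idealr_of (I : R -> Prop) : ideal I -> ~ I 1 ->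
  exists J : idealr R, forall x, x \in J <-> I x.
Proof.
move=> hI h1; pose S := (fun x => `[< I x >]) : R -> bool.
have hS : idealr_closed S.
  split; rewrite ?unfold_in; first exact/asboolP/(ideal0 hI).
    by rewrite /S; apply/asboolPn.
  move=> a u v; rewrite /S !unfold_in => /asboolP hu /asboolP hv.
  by apply/asboolP/(idealD hI) => //; apply: (idealM hI).
pose J : idealr R := HB.pack S (isIdealr.Build R S hS).
by exists J => x; rewrite unfold_in /=; split=> /asboolP.
Qed.

Lemma ideal_of_idealr (J : idealr R) : ideal (fun x => x \in J).
Proof.
apply: idealP; first exact: idealr0.
  by move=> x y hx hy; apply: rpredD.
by move=> a x; apply: idealMr.
Qed.

Lemma isprime_of_prime_idealr (J : prime_idealr R) : isprime (fun x => x \in J).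
Proof.
split; first exact: ideal_of_idealr.
  by rewrite idealr1.
by move=> u v; rewrite prime_idealrM => /orP.
Qed.

Lemma isprime_exp P u k : isprime P -> P (u ^+ k) -> P u.
Proof.
case=> _ h1 hP; elim: k => [|k IH]; first by rewrite expr0.
by rewrite exprS => /hP [].
Qed.

(* The submodule [(x_0, ..., x_(j-1)) B]. *)
Fixpoint inI (V : lmodType R) (x : nat -> R) (j : nat) (B : V -> Prop) (v : V) : Prop :=
  if j is i.+1 then exists2 b, B b & inI x i B (v - x i *: b) else v = 0.

Definition idl (x : nat -> R) (j : nat) : R -> Prop :=
  @inI R^o x j (fun=> True).

Lemma inI_submod (V : lmodType R) x j (B : V -> Prop) : submod B -> submod (inI x j B).
Proof.
move=> hB; elim: j => [|j IH] /=.
  by split=> // a u v -> ->; rewrite scaler0 addr0.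
split; first by exists 0; rewrite ?scaler0 ?subr0; [exact: submod0 | exact: submod0].
move=> a u v [b hb hu] [c hc hv]; exists (a *: b + c); first by case: hB => _; apply.
have -> : a *: u + v - x j *: (a *: b + c) = a *: (u - x j *: b) + (v - x j *: c).
  by rewrite scalerDr scalerBr !scalerA [x j * a]mulrC opprD addrACA.
by case: IH => _; apply.
Qed.

Lemma submod_full (V : lmodType R) : @submod V (fun=> True).
Proof. by []. Qed.

Lemma inIT_submod (V : lmodType R) x j : submod (inI x j (fun _ : V => True)).
Proof. exact: inI_submod (submod_full V). Qed.

Lemma ideal_idl x j : ideal (idl x j).
Proof. exact: inI_submod (submod_full _). Qed.

Lemma inI_S (V : lmodType R) x j (B : V -> Prop) v : submod B ->
  inI x j B v -> inI x j.+1 B v.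
Proof. by move=> hB h; exists 0; rewrite ?scaler0 ?subr0 //; apply: submod0. Qed.

Lemma inI_le (V : lmodType R) x j k (B : V -> Prop) v : submod B -> (j <= k)%N ->
  inI x j B v -> inI x k B v.
Proof.
move=> hB /subnK <-; elim: (k - j)%N => [|i IH] // h.
by rewrite addSn; apply: inI_S => //; apply: IH.
Qed.

Lemma inI_last (V : lmodType R) x j (B : V -> Prop) v : submod B ->
  B v -> inI x j.+1 B (x j *: v).
Proof. by move=> hB h; exists v => //; rewrite subrr; apply: submod0 (inI_submod _ _ hB). Qed.

Lemma inI_mem (V : lmodType R) x i j (B : V -> Prop) v : submod B -> (i < j)%N ->
  B v -> inI x j B (x i *: v).
Proof. by move=> hB hij h; apply: (inI_le hB hij); apply: inI_last. Qed.

Lemma inI_mono (V : lmodType R) x j (B B' : V -> Prop) v : (forall u, B u -> B' u) ->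
  inI x j B v -> inI x j B' v.
Proof.
move=> h; elim: j v => [|j IH] //= v [b hb hv].
by exists b; [exact: h | exact: IH].
Qed.

Lemma inI_morph (V W : lmodType R) x j (f : {linear V -> W}) (B : V -> Prop)
    (B' : W -> Prop) v :
  (forall u, B u -> B' (f u)) -> inI x j B v -> inI x j B' (f v).
Proof.
move=> h; elim: j v => [|j IH] v /=; first by move=> ->; rewrite linear0.
move=> [b hb /IH]; rewrite linearB linearZ /= => hv.
by exists (f b) => //; apply: h.
Qed.

Lemma idlS x j r : idl x j.+1 r <-> exists b, idl x j (r - x j * b).
Proof. by split=> [[b _ h]|[b h]]; exists b. Qed.

Lemma idl_mem x i j : (i < j)%N -> idl x j (x i).
Proof.
move=> hij; have : idl x j (x i * 1) by apply: (inI_mem x (@submod_full R^o) hij).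
by rewrite mulr1.
Qed.

Lemma inI_seq (V : lmodType R) (y : nat -> R) j (x : nat -> R) (B : V -> Prop) v :
  (forall i, (i < j)%N -> x i = y i) -> inI x j B v -> inI y j B v.
Proof.
elim: j v => [|j IH] v //= h [b hb hv]; exists b => //.
by rewrite -h //; apply: IH => // i hi; apply/h/ltnW.
Qed.

End PropSubmodules.

(** * Noetherian rings and chains of primes *)

Section Noetherian.
Local Open Scope ring_scope.
Variable R : comNzRingType.
Hypothesis noethR : noetherian R.
Implicit Types (I K L N P Q : R -> Prop).

Lemma noeth_max (F : (R -> Prop) -> Prop) :
  (forall I, F I -> ideal I) -> (exists I, F I) ->
  exists2 I, F I & forall J, F J -> (forall x, I x -> J x) -> forall x, J x -> I x.
Proof.
move=> hF [I0 hI0]; apply: contrapT => hno.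
have step (I : {I | F I}) : exists J : {I | F I},
    (forall x, sval I x -> sval J x) /\ exists2 x, sval J x & ~ sval I x.
  apply: contrapT => hI; apply: hno; exists (sval I); first exact: (svalP I).
  move=> J hJ hIJ x hx; apply: contrapT => hnx; apply: hI.
  by exists (exist _ J hJ); split=> //; exists x.
have [nxt hnxt] := choice step.
pose C n := sval (iter n nxt (exist _ I0 hI0)).
have hC n : ideal (C n) by apply: hF; apply: (svalP (iter _ _ _)).
have CS n x : C n x -> C n.+1 x by case: (hnxt (iter n nxt (exist _ I0 hI0))) => h _; apply: h.
have Cle n k x : (n <= k)%N -> C n x -> C k x.
  by move=> /subnK <-; elim: (k - n)%N => [|i IH] // h; rewrite addSn; apply/CS/IH.
have Cstrict n : ~ (forall x, C n.+1 x -> C n x).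
  by case: (hnxt (iter n nxt (exist _ I0 hI0))) => _ [x h1 h2] h; apply: h2; apply: h.
pose U x := exists n, C n x.
have hU : ideal U.
  apply: idealP; first by exists 0%N; apply: ideal0.
    move=> x y [n hx] [k hy]; exists (maxn n k); apply: (idealD (hC _)).
      exact: Cle (leq_maxl _ _) hx.
    exact: Cle (leq_maxr _ _) hy.
  by move=> a x [n hx]; exists n; apply: idealM.
(* [noetherian] speaks of proper ideals only; if the union of the chain contains 1, a finite stage
   already does. *)
have [[n h1]|h1] := pselect (U 1).
  by apply: (Cstrict n) => x _; apply: ideal1.
have [J hJ] := idealr_of hU h1.
have [s hs] := noethR J.
have [n hn] : exists n, forall i, (i < size s)%N -> C n s`_i.
  have hsU i : (i < size s)%N -> U s`_i.
    move=> hi; apply/hJ/hs; exists (fun k => (k == i)%:R).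
    rewrite (bigD1 (Ordinal hi)) //= eqxx mul1r big1 ?addr0 // => k.
    by rewrite -val_eqE /= => /negPf ->; rewrite mul0r.
  elim: (size s) hsU => [|k IH] hsU; first by exists 0%N.
  have [n hn] := IH (fun i hi => hsU i (ltnW hi)).
  have [n' hn'] := hsU k (ltnSn k).
  exists (maxn n n') => i; rewrite ltnS leq_eqVlt => /orP [/eqP -> | hi].
    exact: Cle (leq_maxr _ _) hn'.
  exact: Cle (leq_maxl _ _) (hn _ hi).
apply: (Cstrict n) => x hx.
have /hs [c ->] : x \in J by apply/hJ; exists n.+1.
by apply: (submod_sum (hC n)) => i; apply: (idealM (hC n)); apply: hn.
Qed.

Definition ann I w : R -> Prop := fun r => I (r * w).

Lemma ann_ideal I w : ideal I -> ideal (ann I w).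
Proof.
move=> hI; apply: idealP; rewrite /ann; first by rewrite mul0r; apply: ideal0.
  by move=> x y hx hy; rewrite mulrDl; apply: idealD.
by move=> a x hx; rewrite -mulrA; apply: idealM.
Qed.

(** Maximality is only asked along the multiples of [w]: if [u * v] kills [w] and [v] does not, then
    [u] kills the multiple [v * w], hence [w]. *)
Lemma maxann_prime I w : ideal I -> ~ I w ->
  (forall c, ~ I (c * w) -> forall r, I (r * (c * w)) -> I (r * w)) ->
  isprime (ann I w).
Proof.
move=> hI hw hmax; split; rewrite /ann; first exact: ann_ideal.
  by rewrite mul1r.
move=> u v huv; have [hv|hv] := pselect (I (v * w)); first by right.
by left; apply: (hmax v) => //; rewrite mulrA.
Qed.

Lemma exists_ann_prime I z : ideal I -> ~ I z ->
  exists2 c, ~ I (c * z) & isprime (ann I (c * z)).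
Proof.
move=> hI hz.
pose F J := exists2 c, ~ I (c * z) & J = ann I (c * z).
have hF J : F J -> ideal J by move=> [c _ ->]; apply: ann_ideal.
have [|_ [c hc ->] hmax] := noeth_max hF.
  by exists (ann I (1 * z)), 1; rewrite ?mul1r.
exists c => //; apply: maxann_prime => // b hb r hr.
apply: (hmax (ann I (b * (c * z)))) => //; first by exists (b * c); rewrite -mulrA.
by move=> x hx; rewrite /ann mulrCA; apply: idealM.
Qed.

Section AtPrime.
Variable N : R -> Prop.
Hypothesis primeN : isprime N.

(** Ideals of the localization at [N], represented by their contractions to [R], so that the
    localized ring is never built. *)
Definition saturated (J : R -> Prop) := forall u r, ~ N u -> J (u * r) -> J r.

(* The contraction to [R] of [K + (z)] localized at [N]. *)
Definition satadd K z : R -> Prop := fun r => exists u c, ~ N u /\ K (u * r - c * z).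

Lemma notinM u v : ~ N u -> ~ N v -> ~ N (u * v).
Proof. by case: primeN => _ _ h hu hv /h []. Qed.

Lemma notin1 : ~ N 1. Proof. by case: primeN. Qed.

Lemma satadd_ideal K z : ideal K -> ideal (satadd K z).
Proof.
move=> hK; apply: idealP.
- by exists 1, 0; split; [exact: notin1 | rewrite mulr0 mul0r subr0; apply: ideal0].
- move=> x y [u [c [hu hx]]] [v [b [hv hy]]]; exists (u * v), (v * c + u * b).
  split; first exact: notinM.
  have -> : u * v * (x + y) - (v * c + u * b) * z =
    v * (u * x - c * z) + u * (v * y - b * z) by ring.
  by apply: (idealD hK); apply: idealM.
- move=> a x [u [c [hu hx]]]; exists u, (a * c); split=> //.
  have -> : u * (a * x) - a * c * z = a * (u * x - c * z) by ring.
  exact: idealM.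
Qed.

Lemma satadd_sat K z : ideal K -> saturated (satadd K z).
Proof.
move=> hK u r hu [v [c [hv h]]]; exists (v * u), c; split; first exact: notinM.
by rewrite -mulrA.
Qed.

Lemma satadd_sub K z r : K r -> satadd K z r.
Proof. by move=> h; exists 1, 0; split; [exact: notin1 | rewrite mul1r mul0r subr0]. Qed.

Lemma satadd_mem K z : ideal K -> satadd K z z.
Proof. by move=> h; exists 1, 1; split; [exact: notin1 | rewrite subrr; apply: ideal0]. Qed.

(** Take [K] maximal among the saturated ideals over [J] not containing [L]. If [x L] lies in [K],
    the hypothesis puts [L] in [K]. If [x * l0] does not, then [K] enlarged by [x * l0] contains
    [l0] by maximality, and [u - c * x], being outside [N], can be cancelled. *)
Lemma nakayama_sat L (J : R -> Prop) x : ideal L -> ideal J -> saturated J -> N x ->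
  (forall l, L l -> exists u l', [/\ ~ N u, L l' & J (u * l - x * l')]) ->
  forall l, L l -> J l.
Proof.
move=> hL hJ sJ hx hLJ; apply: contrapT => hno.
pose F K := [/\ ideal K, saturated K, (forall r, J r -> K r) & exists2 l, L l & ~ K l].
have FJ : F J.
  split=> //; apply: contrapT => h; apply: hno => l hl.
  by apply: contrapT => hn; apply: h; exists l.
have hF K : F K -> ideal K by case.
have [K [hK sK hJK [l hl hKl]] hmax] := noeth_max hF (ex_intro _ J FJ).
have [hxL|/existsNP [l0 /not_implyP [hl0 hK0]]] := pselect (forall l, L l -> K (x * l)).
  have [u [l' [hu hl' h]]] := hLJ _ hl.
  by apply: hKl; apply: (sK u) => //; apply: (ideal_subr hK (hxL _ hl')); apply: hJK.
have [[l1 hl1 hn1]|hsub] := pselect (exists2 l, L l & ~ satadd K (x * l0) l).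
  apply: hK0; apply: (hmax (satadd K (x * l0))); last exact: satadd_mem.
    split; [exact: satadd_ideal | exact: satadd_sat | | by exists l1].
    by move=> r /hJK; apply: satadd_sub.
  by move=> r; apply: satadd_sub.
have [u [c [hu h]]] : satadd K (x * l0) l0 by apply: contrapT => h; apply: hsub; exists l0.
apply: hK0; apply: (idealM hK); apply: (sK (u - c * x)).
  move=> h'; apply: hu; case: primeN => hN _ _.
  by apply: (ideal_subr hN _ h'); apply: idealM.
by rewrite mulrBl -mulrA.
Qed.

(** When [N] is minimal over [B], the localization of R/B at [N] is Artinian. The proof is
    Noetherian induction on a common lower bound [I] of the chain: a maximal [I] that bounds an
    unstable chain is enlarged by a single [c] whose class spans a simple module. *)
Lemma dcc_sat (B : R -> Prop) (J : nat -> R -> Prop) :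
  (forall Q, isprime Q -> (forall r, B r -> Q r) -> (forall r, Q r -> N r) ->
    forall r, N r -> Q r) ->
  (forall n, ideal (J n)) -> (forall n, saturated (J n)) ->
  (forall n r, B r -> J n r) -> (forall n r, J n.+1 r -> J n r) ->
  exists n, forall r, J n r -> J n.+1 r.
Proof.
move=> hB.
pose dchain (J : nat -> R -> Prop) := [/\ forall n, ideal (J n), forall n, saturated (J n)
  & forall n r, J n.+1 r -> J n r].
pose stable (J : nat -> R -> Prop) := exists n, forall k, (n <= k)%N -> forall r, J n r -> J k r.
move: J.
suff main (J : nat -> R -> Prop) : dchain J -> (forall n r, B r -> J n r) -> stable J.
  move=> J h1 h2 h3 h4; have [n hn] := main J (And3 h1 h2 h4) h3.
  by exists n; apply: hn.
have dle J' n k r : dchain J' -> (n <= k)%N -> J' k r -> J' n r.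
  move=> [_ _ hS] /subnK <-; elim: (k - n)%N => [|i IH] //.
  by rewrite addSn => /hS /IH.
move=> hJ hBJ; apply: contrapT => hst.
pose F I := [/\ ideal I, saturated I, (forall r, B r -> I r) &
  exists2 J, dchain J /\ (forall n r, I r -> J n r) & ~ stable J].
have hF0 : exists I, F I.
  exists (fun r => forall n, J n r); case: (hJ) => h1 h2 h3; split=> //.
  - apply: idealP => [n|x y hx hy n|a x hx n]; first exact: ideal0.
      exact: idealD.
    exact: idealM.
  - by move=> u r hu h n; apply: (h2 n u).
  - by move=> r hr n; apply: hBJ.
  - by exists J => //.
have hF I : F I -> ideal I by case.
have [I [hI sI hBI [C [hC hIC] nstC]] hmax] := noeth_max hF hF0.
have [I1|I1] := pselect (I 1).
  by apply: nstC; exists 0%N => k _ r _; apply: hIC; apply: (ideal1 hI).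
have [c hc hQ] := exists_ann_prime hI I1; rewrite mulr1 in hc hQ.
(* The prime (I : c) contains [B], and lies in [N] because [I] is saturated; by minimality it
   contains [N]. *)
have hNc a : N a -> I (a * c).
  apply: (hB _ hQ) => [r /hBI|r hr]; first by apply: idealMl.
  by apply: contrapT => hNr; apply: hc; apply: (sI r).
case: (hC) => C1 C2 C3.
pose D n := satadd (C n) c.
have hD : dchain D.
  split=> [n|n|n r]; [exact: satadd_ideal | exact: satadd_sat |].
  by move=> [u [a [hu h]]]; exists u, a; split=> //; apply: C3.
have [n1 hn1] : stable D.
  apply: contrapT => hnD; apply: hc; apply: (hmax (satadd I c)); last exact: satadd_mem.
    split; [exact: satadd_ideal | exact: satadd_sat | |].
      by move=> r /hBI; apply: satadd_sub.
    exists D => //; split=> // n r [u [a [hu h]]].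
    by exists u, a; split=> //; apply: hIC.
  by move=> r; apply: satadd_sub.
have [n2 hn2] : exists n2, (forall k, C k c) \/ ~ C n2 c.
  have [h|/existsNP [n2 h]] := pselect (forall k, C k c); first by exists 0%N; left.
  by exists n2; right.
apply: nstC; exists (maxn n1 n2) => k hk r hr.
have [hk1 hk2] : (n1 <= k)%N /\ (n2 <= k)%N by move: hk; rewrite geq_max => /andP [].
have [u [a [hu h]]] : D k r.
  apply: hn1 => //; apply: satadd_sub; apply: dle hr => //; exact: leq_maxl.
apply: (C2 k u) => //.
suff hac : C k (a * c) by apply: (ideal_subr (C1 k) hac).
case: hn2 => [hall|hn2]; first exact/(idealM (C1 k)).
have hac : C n2 (a * c).
  have -> : a * c = u * r - (u * r - a * c) by ring.
  apply: (idealB (C1 n2)); last exact: dle hk2 h.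
  by apply: (idealM (C1 n2)); apply: dle hr => //; apply: leq_maxr.
apply/hIC/hNc; apply: contrapT => hNa; apply: hn2; exact: C2 hNa hac.
Qed.

End AtPrime.

(* Krull's principal ideal theorem.  The ideals [A n = {r | u x^k r \in (a^n) + P}]
   play the part of the symbolic powers: modulo [x] they form a descending chain,
   and where it stops Nakayama gives [a^n \in A n.+1], that is, a power of [x]
   lies in [(a) + P]. *)
Lemma prime_between P Q N x : isprime P -> isprime Q -> isprime N ->
  (forall r, P r -> Q r) -> (exists2 a, Q a & ~ P a) ->
  (forall r, Q r -> N r) -> (exists2 a, N a & ~ Q a) -> N x ->
  exists Q', [/\ isprime Q', forall r, P r -> Q' r, exists2 a, Q' a & ~ P a,
    forall r, Q' r -> N r & exists2 a, N a & ~ Q' a] /\ Q' x.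
Proof.
move=> pP pQ pN hPQ [a hQa hPa] hQN hNQ hNx.
have [hQx|hQx] := pselect (Q x); first by exists Q; split=> //; split=> //; exists a.
apply: contrapT => hno; case: (pP) (pQ) (pN) => [iP P1 mP] [iQ Q1 mQ] [iN N1 mN].
pose B r := exists c, P (r - c * x).
have hB Q' : isprime Q' -> (forall r, B r -> Q' r) -> (forall r, Q' r -> N r) ->
    forall r, N r -> Q' r.
  move=> pQ' hBQ hQ'N r hr; apply: contrapT => hn; apply: hno; exists Q'.
  have Q'x : Q' x by apply: hBQ; exists 1; rewrite mul1r subrr; apply: ideal0.
  split=> //; split=> //; last by exists r.
    by move=> s hs; apply: hBQ; exists 0; rewrite mul0r subr0.
  by exists x => // /hPQ.
pose A n r := exists k u c, ~ N u /\ P (u * x ^+ k * r - a ^+ n * c).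
have iA n : ideal (A n).
  apply: idealP.
  - by exists 0%N, 1, 0; split=> //; rewrite !mulr0 subr0; apply: ideal0.
  - move=> r s [k [u [c [hu hr]]]] [l [v [b [hv hs]]]].
    exists (k + l)%N, (u * v), (v * x ^+ l * c + u * x ^+ k * b).
    split; first exact: (notinM pN).
    have -> : u * v * x ^+ (k + l) * (r + s) - a ^+ n * (v * x ^+ l * c + u * x ^+ k * b)
      = (v * x ^+ l) * (u * x ^+ k * r - a ^+ n * c) +
        (u * x ^+ k) * (v * x ^+ l * s - a ^+ n * b) by rewrite exprD; ring.
    by apply: (idealD iP); apply: (idealM iP).
  - move=> b r [k [u [c [hu hr]]]]; exists k, u, (b * c); split=> //.
    have -> : u * x ^+ k * (b * r) - a ^+ n * (b * c) = b * (u * x ^+ k * r - a ^+ n * c) by ring.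
    exact: (idealM iP).
have sA n : saturated N (A n).
  move=> v r hv [k [u [c [hu hr]]]]; exists k, (u * v), c; split; first exact: (notinM pN).
  have -> : u * v * x ^+ k * r = u * x ^+ k * (v * r) by ring.
  by [].
(* The factor [x ^+ k] in [A] makes [x] a nonzerodivisor modulo [A n]. Hence an element of [A n]
   congruent to [c * x] modulo [A n.+1] has its cofactor [c] in [A n], as Nakayama requires. *)
have xA n r : A n (x * r) -> A n r.
  move=> [k [u [c [hu hr]]]]; exists k.+1, u, c; split=> //.
  have -> : u * x ^+ k.+1 * r = u * x ^+ k * (x * r) by rewrite exprSr; ring.
  by [].
have AS n r : A n.+1 r -> A n r.
  move=> [k [u [c [hu hr]]]]; exists k, u, (a * c); split=> //.
  by rewrite mulrA -exprSr.
have [||||n hn] := @dcc_sat N pN B (fun n => satadd N (A n) x) hB.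
- by move=> n; apply: satadd_ideal.
- by move=> n; apply: satadd_sat.
- move=> n r [c hc]; exists 1, c; split=> //; exists 0%N, 1, 0; split=> //.
  by rewrite expr0 !mul1r mulr0 subr0.
- by move=> n r [u [c [hu h]]]; exists u, c; split=> //; apply: AS.
have hAn : A n (a ^+ n).
  by exists 0%N, 1, 1; split=> //; rewrite expr0 !mul1r mulr1 subrr; apply: ideal0.
have [k [u [c [hu h]]]] : A n.+1 (a ^+ n).
  apply: (@nakayama_sat N pN (A n) (A n.+1) x) => // l hl.
  have [u [c [hu h]]] := hn l (satadd_sub pN x hl).
  exists u, c; split=> //; last by rewrite [x * c]mulrC.
  apply: xA; rewrite mulrC.
  have -> : c * x = u * l - (u * l - c * x) by ring.
  by apply: (idealB (iA n)); [apply: (idealM (iA n)) | apply: AS].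
have {}h : P (a ^+ n * (u * x ^+ k - a * c)).
  have -> : a ^+ n * (u * x ^+ k - a * c) = u * x ^+ k * a ^+ n - a ^+ n.+1 * c.
    by rewrite exprSr; ring.
  by [].
(* Since [a] is outside [P], the other factor is in [P], so [u * x ^+ k] is in [Q]; but [u] is
   outside [N] and [x] outside [Q]. *)
case: (mP _ _ h) => [/(isprime_exp pP)|/hPQ h'] //.
have : Q (u * x ^+ k).
  by apply: (ideal_subr iQ _ h'); rewrite mulrC; apply: (idealM iQ).
by case/mQ => [/hQN|/(isprime_exp pQ)].
Qed.

Definition pchain n (P : nat -> R -> Prop) : Prop :=
  (forall i, (i <= n)%N -> isprime (P i)) /\
  (forall i, (i < n)%N -> (forall r, P i r -> P i.+1 r) /\ exists2 a, P i.+1 a & ~ P i a).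

(** The element [x] is pushed down the chain one prime at a time: [prime_between] replaces the prime
    below the top by one containing [x], and induction treats the chain that ends there. *)
Lemma chain_shift n (P : nat -> R -> Prop) x : pchain n.+1 P -> P n.+1 x ->
  exists2 P', pchain n P' & [/\ P' n = P n.+1, forall r, P 0%N r -> P' 0%N r,
    exists2 a, P' 0%N a & ~ P 0%N a & P' 0%N x].
Proof.
elim: n P => [|n IH] P [pP sP] hx.
  exists (fun=> P 1%N); first by split=> // i _; apply: pP.
  by have [h1 h2] := sP 0%N isT; split.
have [h1 h2] := sP n (leqW (ltnSn n)); have [h3 h4] := sP n.+1 (ltnSn _).
have [Q [[pQ hPQ nPQ hQP nQP] hQx]] :=
  prime_between (pP n (leqW (leqnSn n))) (pP n.+1 (leqnSn _)) (pP n.+2 (leqnn _)) h1 h2 h3 h4 hx.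
pose C i := if (i == n.+1)%N then Q else P i.
have Clt i : (i <= n)%N -> C i = P i by rewrite /C => h; rewrite ltn_eqF.
have CS : C n.+1 = Q by rewrite /C eqxx.
have hC : pchain n.+1 C.
  split=> i; rewrite leq_eqVlt => /orP [/eqP e|].
  - by rewrite e CS.
  - by rewrite ltnS => hi; rewrite Clt //; apply/pP/leqW/leqW.
  - by case: e => ->; rewrite Clt // CS.
  - by rewrite ltnS => hi; rewrite !Clt ?(ltnW hi) //; apply: sP; apply: leqW; apply: leqW.
have [||C' [pC' sC'] [e hC0 nC0 xC0]] := IH C; [by [] | by rewrite CS |].
pose D i := if (i == n.+1)%N then P n.+2 else C' i.
have Dlt i : (i <= n)%N -> D i = C' i by rewrite /D => h; rewrite ltn_eqF.
have DS : D n.+1 = P n.+2 by rewrite /D eqxx.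
exists D; last by rewrite DS Dlt // -(Clt 0%N).
split=> i; rewrite leq_eqVlt => /orP [/eqP ei|].
- by rewrite ei DS; apply: pP.
- by rewrite ltnS => hi; rewrite Dlt //; apply: pC'.
- by case: ei => ->; rewrite Dlt // DS e CS.
- by rewrite ltnS => hi; rewrite !Dlt ?(ltnW hi) //; apply: sC'.
Qed.

End Noetherian.

(** * Regular local rings *)

Section Local.
Local Open Scope ring_scope.
Variable R : comNzRingType.
Hypothesis noethR : noetherian R.
Variable m : R -> Prop.
Hypothesis primem : isprime m.
Hypothesis unit_notin : forall u, ~ m u -> exists v, v * u = 1.

Lemma proper_sub (I : R -> Prop) r : ideal I -> ~ I 1 -> I r -> m r.
Proof.
move=> hI h1 hr; apply: contrapT => /unit_notin [v hv].
by apply: h1; rewrite -hv; apply: idealM.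
Qed.

Lemma ideal_saturated (J : R -> Prop) : ideal J -> saturated m J.
Proof.
move=> hJ u r /unit_notin [v hv] h.
by rewrite -[r]mul1r -hv -mulrA; apply: idealM.
Qed.

Lemma nakayama (L J : R -> Prop) x : ideal L -> ideal J -> m x ->
  (forall l, L l -> exists2 l', L l' & J (l - x * l')) -> forall l, L l -> J l.
Proof.
move=> hL hJ hx h; apply: (nakayama_sat noethR primem hL hJ _ hx).
  exact: ideal_saturated.
move=> l /h [l' hl' hJl]; exists 1, l'; split=> //; last by rewrite mul1r.
by case: primem.
Qed.

Section RegularParameters.
Variables (d : nat) (y : nat -> R).
Hypothesis my : forall r, m r <-> idl y d r.

Lemma parameter_in i : (i < d)%N -> m (y i).
Proof.
by move=> hi; apply/my/idl_mem.
Qed.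

Lemma idl_sub_prime (P : R -> Prop) j : isprime P -> (forall r, idl y j r -> P r) ->
  P (y j) -> forall r, idl y j.+1 r -> P r.
Proof.
move=> [iP _ _] hj hy r /idlS [b /hj]; apply: (ideal_subr iP).
exact: idealMl.
Qed.

Lemma chain_cut k n (P : nat -> R -> Prop) : (k < d)%N -> pchain n.+1 P ->
  (forall r, idl y (d - k.+1) r -> P 0%N r) ->
  exists2 P', pchain n P' &
    [/\ forall r, idl y (d - k) r -> P' 0%N r, forall r, P 0%N r -> P' 0%N r
      & exists2 a, P' 0%N a & ~ P 0%N a].
Proof.
move=> hk [pP sP] h0; have ej : (d - k)%N = (d - k.+1).+1 by rewrite subnSK.
have hsub i r : (i <= n.+1)%N -> P i r -> m r.
  by move=> hi; apply: proper_sub; case: (pP i hi).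
(* The top prime need not contain the next parameter, so it is first raised to [m]. *)
pose C i := if (i == n.+1)%N then m else P i.
have Clt i : (i <= n)%N -> C i = P i by rewrite /C => h; rewrite ltn_eqF.
have CS : C n.+1 = m by rewrite /C eqxx.
have hC : pchain n.+1 C.
  split=> i; rewrite leq_eqVlt => /orP [/eqP e|].
  - by rewrite e CS.
  - by rewrite ltnS => hi; rewrite Clt //; apply/pP/leqW.
  - case: e => ->; rewrite Clt // CS; split=> [r|]; first exact/hsub/leqW.
    have [_ [a h1 h2]] := sP n (ltnSn n).
    by exists a => //; apply: (hsub n.+1).
  - by rewrite ltnS => hi; rewrite !Clt ?(ltnW hi) //; apply: sP; apply: leqW.
have hy : C n.+1 (y (d - k.+1)%N).
  rewrite CS; apply: parameter_in; rewrite -ej; exact: leq_subr.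
have [P' pP' [_ h1 h2 h3]] := chain_shift noethR hC hy.
rewrite Clt // in h1 h2.
exists P' => //; split=> // r; rewrite ej; apply: idl_sub_prime => //.
  by case: pP' => h _; apply: h.
by move=> s /h0/h1.
Qed.

(** Each cut costs one step of the chain and puts one more parameter into its bottom. Once all [d]
    are there the bottom is [m], with no prime strictly above. *)
Lemma height_bound k n (P : nat -> R -> Prop) : (k <= d)%N -> pchain n P ->
  (forall r, idl y (d - k) r -> P 0%N r) -> (n <= k)%N.
Proof.
elim: k n P => [|k IH] [|n] P hk hP h0 //.
  case: hP => pP sP; have [_ [a ha na]] := sP 0%N isT; case: na; apply: h0.
  by rewrite subn0; apply/my; apply: proper_sub ha; case: (pP 1%N isT).
have [P' hP' [h0' _ _]] := chain_cut hk hP h0.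
exact: (IH n P' (ltnW hk)).
Qed.

Hypothesis dim_ge : exists P : nat -> R -> Prop, pchain d P.

Lemma chain_above k : (k <= d)%N ->
  exists2 P : nat -> R -> Prop, pchain k P & forall r, idl y (d - k) r -> P 0%N r.
Proof.
move=> hk; rewrite -{1}(subKn hk); elim: (d - k)%N (leq_subr k d) => [|i IH] hi.
  have [P hP] := dim_ge; exists P => //; first by rewrite subn0.
  by move=> r ->; case: hP => pP _; apply: ideal0; case: (pP 0%N isT).
have [P hP h0] := IH (ltnW hi).
have e : (d - i)%N = (d - i.+1).+1 by rewrite subnSK.
rewrite e in hP; have hk' : (d - i.+1 < d)%N by rewrite -e leq_subr.
have [|P' hP' [h0' _ _]] := chain_cut hk' hP; first by rewrite -e subKn // ltnW.
by exists P' => //; rewrite subKn // in h0'.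
Qed.

(** Quotients by initial parameters are domains, by removing one parameter [y] at a time from [m]. A
    chain of length [k.+1] above the smaller ideal has a bottom prime that misses [y], by
    [height_bound], and that lies in the larger ideal, already known to be prime. So each of its
    elements is, modulo the smaller ideal, [y] times another of its elements, and Nakayama
    identifies the two. *)
Lemma idl_prime k : (k <= d)%N ->
  isprime (idl y (d - k)) /\ ((0 < k)%N -> ~ idl y (d - k) (y (d - k)%N)).
Proof.
elim: k => [|k IH] hk.
  split=> //; rewrite subn0; have -> // : idl y d = m.
  by apply/funext => r; apply/propext; rewrite my.
have [pI _] := IH (ltnW hk); have [P hP h0] := chain_above hk.
have ej : (d - k)%N = (d - k.+1).+1 by rewrite subnSK.
have [P' hP' [h0' hPP' nPP']] := chain_cut hk hP h0.
have [pP pP'] : isprime (P 0%N) /\ isprime (P' 0%N).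
  by case: hP hP' => h _ [h' _]; split; [exact: h | exact: h'].
have iI := ideal_idl y (d - k.+1).
have iP : ideal (P 0%N) by case: pP.
have nP : ~ P 0%N (y (d - k.+1)%N).
  move=> hy; have : (k.+1 <= k)%N; last by rewrite ltnn.
  apply: (height_bound (ltnW hk) hP); rewrite ej; exact: idl_sub_prime.
have eP r : P 0%N r -> idl y (d - k) r.
  have hsub r' : P' 0%N r' -> idl y (d - k) r'.
    move=> hr'; apply: contrapT => hn.
    have : (k.+1 <= k)%N; last by rewrite ltnn.
    pose C i := if i is j.+1 then P' j else idl y (d - k).
    apply: (@height_bound k k.+1 C (ltnW hk)) => //.
    case: hP' => p1 p2; split=> -[|i] hi //=; [exact: p1 | | exact: p2].
    by split=> //; exists r'.
  by move=> /hPP'/hsub.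
have hsub : forall r, P 0%N r -> idl y (d - k.+1) r.
  apply: (@nakayama _ _ (y (d - k.+1)%N)) => //.
    by apply: parameter_in; rewrite -ej leq_subr.
  move=> r hr; have := eP r hr; rewrite ej => /idlS [a h]; exists a => //.
  have : P 0%N (y (d - k.+1)%N * a).
    have -> : y (d - k.+1)%N * a = r - (r - y (d - k.+1)%N * a) by ring.
    by apply: (idealB iP) => //; apply: h0.
  by case: pP => _ _ hp /hp [].
have e : idl y (d - k.+1) = P 0%N.
  by apply/funext => r; apply/propext; split; [apply: h0 | apply: hsub].
by rewrite e.
Qed.

Lemma parameters_regular i r : (i < d)%N -> idl y i (y i * r) -> idl y i r.
Proof.
move=> hi; have hk : (d - i <= d)%N by apply: leq_subr.
have := idl_prime hk; rewrite subKn ?(ltnW hi) // subn_gt0 => -[[_ _ h] h'].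
by move=> /h [] // /(h' hi).
Qed.

(** A prime strictly between [P] and [m] would prolong [C] by two steps, beyond the dimension. *)
Lemma primes_adjacent (P Q : R -> Prop) n (C : nat -> R -> Prop) :
  pchain n C -> C n = P -> (d <= n.+1)%N -> isprime Q ->
  (forall r, P r -> Q r) -> (exists2 a, Q a & ~ P a) -> forall r, m r -> Q r.
Proof.
move=> [pC sC] eC hn pQ hPQ nPQ r hr; apply: contrapT => hnQ.
pose D i := if (i <= n)%N then C i else if (i == n.+1)%N then Q else m.
have Dlt i : (i <= n)%N -> D i = C i by rewrite /D => ->.
have D1 : D n.+1 = Q by rewrite /D ltnn eqxx.
have D2 : D n.+2 = m by rewrite /D leqNgt ltnW // -{2}[n.+1]addn0 eqn_leq addn0 ltnn.
have hD : pchain n.+2 D.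
  split=> i; rewrite leq_eqVlt => /orP [/eqP e|].
  - by rewrite e D2.
  - rewrite ltnS leq_eqVlt => /orP [/eqP e|]; first by rewrite e D1.
    by rewrite ltnS => hi; rewrite Dlt //; apply: pC.
  - case: e => ->; rewrite D1 D2; split; last by exists r.
    by move=> s; apply: proper_sub; case: pQ.
  - rewrite ltnS leq_eqVlt => /orP [/eqP [->]|].
      by rewrite D1 Dlt // eC.
    by rewrite ltnS => hi; rewrite !Dlt ?(ltnW hi) //; apply: sC.
have : (n.+2 <= d)%N.
  apply: (height_bound (leqnn d) hD); rewrite subnn => s ->.
  by rewrite Dlt //; apply: ideal0; case: (pC 0%N isT).
by move=> /leq_trans /(_ hn); rewrite ltnn.
Qed.

End RegularParameters.
End Local.

(** * Free modules and regular sequences *)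

Section FreeModules.
Local Open Scope ring_scope.
Variable R : comNzRingType.

Section Extension.
Variables (T : choiceType) (V : lmodType R).

(** [{malg R[T]}] serves as the free module on [T]; this is the linear map given by the images of
    its basis. *)
Definition ext (g : T -> V) (u : {malg R[T]}) : V :=
  \sum_(k <- msupp u) u@_k *: g k.

Lemma extEw (g : T -> V) (u : {malg R[T]}) (D : {fset T}) :
  (msupp u `<=` D)%fset -> ext g u = \sum_(k <- D) u@_k *: g k.
Proof.
move=> hD; rewrite /ext; apply: (big_fset_incl _ hD) => k _ hk.
by rewrite (mcoeff_outdom hk) scale0r.
Qed.

Lemma ext_is_linear g : linear (ext g).
Proof.
move=> a u v; pose D := (msupp u `|` msupp v `|` msupp (a *: u + v))%fset.
have hu : (msupp u `<=` D)%fset by rewrite /D -fsetUA fsubsetUl.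
have hv : (msupp v `<=` D)%fset by rewrite /D [(msupp u `|` _)%fset]fsetUC -fsetUA fsubsetUl.
have huv : (msupp (a *: u + v) `<=` D)%fset by rewrite fsubsetUr.
rewrite (extEw _ hu) (extEw _ hv) (extEw _ huv) scaler_sumr -big_split /=.
by apply: eq_bigr => k _; rewrite mcoeffD mcoeffZ scalerDl scalerA.
Qed.

HB.instance Definition _ g :=
  GRing.isLinear.Build R {malg R[T]} V *:%R (ext g) (ext_is_linear g).

Lemma extU g c k : ext g << c *g k >> = c *: g k.
Proof.
by rewrite (extEw _ (msuppU_le (k := k) (x := c))) big_seq_fset1 mcoeffUU.
Qed.

Lemma ext_uniq (f : {linear {malg R[T]} -> V}) u : f u = ext (fun k => f << k >>) u.
Proof.
rewrite {1}[u]monalgE linear_sum /ext; apply: eq_bigr => k _.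
rewrite -linearZ /=; congr (f _); apply/malgP => k'.
by rewrite mcoeffZ !mcoeffU mulrnAr mulr1.
Qed.

Lemma linear_ext (W : lmodType R) (f : {linear V -> W}) g u : f (ext g u) = \sum_(k <- msupp u) u@_k *: f (g k).
Proof. by rewrite linear_sum; apply: eq_bigr => k _; rewrite linearZ. Qed.

End Extension.

Lemma ext_fin (T : finType) (V : lmodType R) (g : T -> V) u :
  ext g u = \sum_k u@_k *: g k.
Proof.
rewrite /ext big_uniq ?fset_uniq //= big_mkcond /=; apply: eq_bigr => k _.
by case: ifPn => // hk; rewrite (mcoeff_outdom hk) scale0r.
Qed.

Section Coordinates.
Variable T : choiceType.

Definition coord (k : T) (u : {malg R[T]}) : R^o := u@_k.

Lemma coord_is_linear k : linear (coord k).
Proof. by move=> a u v; rewrite /coord mcoeffD mcoeffZ. Qed.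

HB.instance Definition _ k :=
  GRing.isLinear.Build R {malg R[T]} R^o *:%R (coord k) (coord_is_linear k).

Definition monom (k : T) (a : R^o) : {malg R[T]} := << (a : R) *g k >>.

Lemma monom_is_linear k : linear (monom k).
Proof.
move=> a u v; apply/malgP => k'; rewrite mcoeffD mcoeffZ !mcoeffU.
by case: (k == k'); rewrite ?mulr1n ?mulr0n ?mulr0 ?addr0.
Qed.

HB.instance Definition _ k :=
  GRing.isLinear.Build R R^o {malg R[T]} *:%R (monom k) (monom_is_linear k).

Lemma inI_coord x j (u : {malg R[T]}) :
  inI x j (fun=> True) u <-> forall k, idl x j u@_k.
Proof.
split=> [h k|h]; first exact: (inI_morph (f := coord k) (B' := fun=> True) _ h).
rewrite [u]monalgE; apply: submod_sum; first exact: inIT_submod.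
by move=> k; apply: (inI_morph (f := monom k) (B' := fun=> True) _ (h k)).
Qed.

End Coordinates.

Lemma malg_projective (T : choiceType) : projective_module {malg R[T]}.
Proof.
move=> M N q f hq.
have [h hh] := choice (fun k => hq (f << k >>)).
exists (ext h) => u; rewrite (ext_uniq f) /ext linear_sum.
by apply: eq_bigr => k _; rewrite linearZ /= hh.
Qed.

Lemma projective_split (P : lmodType R) : projective_module P ->
  exists g : {linear P -> {malg R[P]}}, forall v, ext id (g v) = v.
Proof.
move=> hP; have hs : surjective_map (ext (id : P -> P)).
  by move=> v; exists << v >>; rewrite extU scale1r.
have [g hg] := hP _ _ (ext (id : P -> P)) (idfun : {linear P -> P}) hs.
by exists g.
Qed.

End FreeModules.

(** * Weakly regular sequences on syzygies and projective modules *)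

Section WeaklyRegular.
Local Open Scope ring_scope.
Variable R : comNzRingType.
Variable x : nat -> R.

Definition wreg (V : lmodType R) (j : nat) (B : V -> Prop) : Prop :=
  forall i, (i < j)%N -> forall v, B v -> inI x i B (x i *: v) -> inI x i B v.

Lemma wreg_le (V : lmodType R) j k (B : V -> Prop) : (j <= k)%N -> wreg k B -> wreg j B.
Proof. by move=> hjk h i hi; apply: h; apply: leq_trans hjk. Qed.

Lemma inI_lift (V W : lmodType R) (q : {linear V -> W}) (A : V -> Prop) (B : W -> Prop) j w :
  (forall w, B w -> exists2 v, A v & q v = w) -> inI x j B w ->
  exists2 v, inI x j A v & q v = w.
Proof.
move=> hq; elim: j w => [|j IH] w /=; first by move=> ->; exists 0; rewrite ?linear0.
move=> [b /hq [a ha <-] /IH [v hv e]]; exists (v + x j *: a).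
  by exists a => //; rewrite addrK.
by rewrite linearD linearZ /= e subrK.
Qed.

Section Syzygy.
Variables (P V : lmodType R) (q : {linear P -> V}) (B : V -> Prop).
Hypothesis imq : forall v, B v <-> exists u, q u = v.

(* [Tor_1 (R / (x_0, ..., x_(j-1)), B) = 0]. *)
Lemma inI_ker j u : wreg j B -> q u = 0 -> inI x j (fun=> True) u ->
  inI x j (fun u => q u = 0) u.
Proof.
elim: j u => [|j IH] u hB hu //= [b _ hb].
have Bq w : True -> B (q w) by move=> _; apply/imq; exists w.
have hqb : inI x j B (q b).
  apply: hB => //; first exact: Bq.
  have := inI_morph (f := q) Bq hb; rewrite linearB linearZ /= hu sub0r => h.
  rewrite -[_ *: _]opprK; apply: submodN h; apply: inI_submod.
  split; first by apply/imq; exists 0; rewrite linear0.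
  move=> a v w /imq [s <-] /imq [t <-]; apply/imq; exists (a *: s + t).
  by rewrite linearP.
have [|c hc ec] := inI_lift (q := q) (A := fun=> True) _ hqb.
  by move=> w /imq [v <-]; exists v.
exists (b - c); first by rewrite linearB /= ec subrr.
apply: IH; first exact: wreg_le hB.
  by rewrite linearB linearZ /= hu linearB /= ec subrr scaler0 subrr.
rewrite scalerBr opprB addrCA addrC.
apply: submodD => //; first exact: inIT_submod.
by apply: submodZ => //; exact: inIT_submod.
Qed.

(** A syzygy gains one term over [B]: by [inI_ker], the multiples (x)P meet the kernel exactly in
    (x) times the kernel, so regularity restricts from [P]. *)
Lemma wreg_ker j k : (k <= j.+1)%N -> wreg j B -> wreg k (fun _ : P => True) ->
  wreg k (fun u => q u = 0).
Proof.
move=> hk hB hP i hi v hv h; apply: inI_ker => //.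
  by apply: wreg_le hB; rewrite -ltnS; apply: leq_trans hk.
by apply: hP => //; apply: inI_mono h.
Qed.

End Syzygy.

Variable d : nat.
Hypothesis regx : forall i r, (i < d)%N -> idl x i (x i * r) -> idl x i r.

Lemma wreg_free (T : choiceType) : wreg d (fun _ : {malg R[T]} => True).
Proof.
move=> i hi v _ /inI_coord h; apply/inI_coord => k; apply: regx => //.
by have := h k; rewrite mcoeffZ.
Qed.

Lemma wreg_projective (P : lmodType R) : projective_module P -> wreg d (fun _ : P => True).
Proof.
move=> /projective_split [g hg] i hi v _ h.
rewrite -[v]hg; apply: (inI_morph (B := fun=> True)) => //.
apply: wreg_free => //; rewrite -linearZ.
by apply: (inI_morph (B := fun=> True)) h.
Qed.

End WeaklyRegular.

(** * Finitely generated modules, minimal generators and freeness *)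

Section FinitelyGenerated.
Local Open Scope ring_scope.
Variable R : comNzRingType.
Hypothesis noethR : noetherian R.

Fixpoint span (V : lmodType R) (s : seq V) (v : V) : Prop :=
  if s is g :: s' then exists a, span s' (v - a *: g) else v = 0.

Definition fg (V : lmodType R) (B : V -> Prop) : Prop :=
  exists s, forall v, B v <-> span s v.

Lemma span_submod (V : lmodType R) (s : seq V) : submod (span s).
Proof.
elim: s => [|g s IH] /=; first by split=> // a u v -> ->; rewrite scaler0 addr0.
split; first by exists 0; rewrite scale0r subr0; apply: submod0.
move=> a u v [b hu] [c hv]; exists (a * b + c).
have -> : a *: u + v - (a * b + c) *: g = a *: (u - b *: g) + (v - c *: g).
  by rewrite scalerBr scalerDl scalerA opprD addrACA.
by case: IH => _; apply.
Qed.

Lemma span_mem (V : lmodType R) (s : seq V) v : v \in s -> span s v.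
Proof.
elim: s => [|g s IH] /=; first by rewrite in_nil.
rewrite inE => /orP [/eqP ->|/IH h]; last by exists 0; rewrite scale0r subr0.
by exists 1; rewrite scale1r subrr; exact: submod0 (span_submod _).
Qed.

Lemma span_cat (V : lmodType R) (s t : seq V) v w : span s v -> span t (w - v) -> span (s ++ t) w.
Proof.
elim: s v w => [|g s IH] v w /=; first by move=> ->; rewrite subr0.
move=> [a hv] hw; exists a; apply: (IH _ _ hv).
by rewrite opprB addrA subrK.
Qed.

Lemma span_sub (V : lmodType R) (s : seq V) (B : V -> Prop) v : submod B ->
  (forall g, g \in s -> B g) -> span s v -> B v.
Proof.
move=> hB; elim: s v => [|g s IH] v /= hs; first by move=> ->; apply: submod0.
move=> [a /IH h]; apply: (submod_subr hB (v := a *: g)); last first.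
  by apply: h => t ht; apply: hs; rewrite inE ht orbT.
by apply: submodZ => //; apply: hs; rewrite mem_head.
Qed.

Lemma spanP (V : lmodType R) (s : seq V) v :
  span s v <-> exists c : nat -> R, v = \sum_(i < size s) c i *: s`_i.
Proof.
elim: s v => [|g s IH] v /=.
  by split=> [->|[c ->]]; [exists (fun=> 0) |]; rewrite big_ord0.
split=> [[a /IH [c e]]|[c ->]].
  exists (fun i => if i is j.+1 then c j else a).
  by rewrite big_ord_recl /= -e addrC subrK.
exists (c 0%N); apply/IH; exists (fun i => c i.+1).
by rewrite big_ord_recl /= addrC addrA addNr add0r.
Qed.

Lemma ideal_fg (I : R -> Prop) : ideal I -> @fg R^o I.
Proof.
move=> hI; have [h1|h1] := pselect (I 1).
  exists [:: (1 : R^o)] => v; split=> [_|_] /=; last exact: (ideal1 hI).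
  by exists v; rewrite /GRing.scale /= mulr1 subrr.
have [J hJ] := idealr_of hI h1; have [s hs] := noethR J.
exists (s : seq R^o) => v; split=> [/hJ/hs [c hc]|/spanP [c hc]].
  by apply/spanP; exists c.
by apply/hJ/hs; exists c.
Qed.

(** Induction on [s]: the possible coefficients of [g] in elements of [B] form an ideal [I]. Lifts
    to [B] of generators of [I] (the list [s2]) and generators of the part of [B] inside [span s]
    (the list [s1]) together generate [B]. *)
Lemma fg_sub (V : lmodType R) (s : seq V) (B : V -> Prop) : submod B ->
  (forall v, B v -> span s v) -> fg B.
Proof.
elim: s B => [|g s IH] B hB hs.
  exists [::] => v; split=> [/hs //|->]; exact: submod0.
pose I a := exists2 v, B v & span s (v - a *: g).
have hI : ideal I.
  apply: idealP.
  - by exists 0; rewrite ?scale0r ?subr0; apply: submod0 => //; apply: span_submod.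
  - move=> a b [v hv hv'] [w hw hw']; exists (v + w); first exact: submodD.
    by rewrite scalerDl opprD addrACA; apply: submodD => //; apply: span_submod.
  - move=> a b [v hv hv']; exists (a *: v); first exact: submodZ.
    by rewrite -scalerA -scalerBr; apply: submodZ => //; apply: span_submod.
have [t ht] := ideal_fg hI.
have [s1 hs1] := IH (fun v => B v /\ span s v) (conj (conj (submod0 hB) (submod0 (span_submod s)))
   (fun a u v '(conj h1 h2) '(conj h3 h4) =>
      conj (proj2 hB a u v h1 h3) (proj2 (span_submod s) a u v h2 h4)))
   (fun v h => proj2 h).
have [s2 hs2B hs2] : exists2 s2, forall v, v \in s2 -> B v &
    forall v a, span t a -> span s (v - a *: g) -> exists2 w, span s2 w & span s (v - w).
  have htI a : a \in t -> I a.
    by move=> hat; apply/ht/span_mem.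
  elim: t htI {ht} => [|b t IHt] htI.
    exists [::] => // v a -> h; exists 0 => //.
    by rewrite scale0r in h.
  have [a hat|s2 hs2B hs2] := IHt; first by apply: htI; rewrite inE hat orbT.
  have [v0 hv0 hsv0] := htI b (mem_head _ _).
  exists (v0 :: s2).
    by move=> v; rewrite inE => /orP [/eqP ->|/hs2B].
  move=> v a [c hc] hv.
  have [|w hw hvw] := hs2 (v - c *: v0) _ hc.
    have -> : v - c *: v0 - (a - c *: b) *: g = (v - a *: g) - c *: (v0 - b *: g).
      rewrite scalerBl scalerBr -scalerA !opprB; rewrite -!addrA; congr (_ + _).
      by rewrite addrC -!addrA addrC -!addrA; congr (_ + _); rewrite addrC.
    by apply: submodB; [exact: span_submod | | apply: submodZ => //; exact: span_submod].
  exists (w + c *: v0); first by exists c; rewrite addrK.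
  by rewrite opprD addrA addrAC.
exists (s2 ++ s1) => v; split=> [hv|].
  have [a hva] := hs _ hv.
  have [|w hw hvw] := hs2 v a _ hva; first by apply/ht; exists v.
  apply: (span_cat hw); apply/hs1; split=> //.
  by apply: submodB => //; apply: span_sub hw.
apply: span_sub => // w; rewrite mem_cat => /orP [/hs2B //|hw].
by have /hs1 [] := span_mem hw.
Qed.

Definition generates (V : lmodType R) (T : choiceType) (g : T -> V) (B : V -> Prop) : Prop :=
  forall v, B v <-> exists u, ext g u = v.

Lemma fg_generates (V : lmodType R) (B : V -> Prop) : fg B ->
  exists r (g : 'I_r -> V), generates g B.
Proof.
move=> [s hs]; exists (size s), (fun i => s`_i) => v; split=> [/hs/spanP [c ->]|[u <-]].
  exists (\sum_(i < size s) << c i *g i >>).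
  by rewrite linear_sum; apply: eq_bigr => i _; rewrite /= extU.
apply/hs/spanP; rewrite ext_fin.
exists (fun k => if insub k is Some i then u@_i else 0).
by apply: eq_bigr => i _; rewrite valK.
Qed.

Lemma generates_submod (V : lmodType R) (T : choiceType) (g : T -> V) B :
  generates g B -> submod B.
Proof.
move=> h; split; first by apply/h; exists 0; rewrite linear0.
move=> a u v /h [s <-] /h [t <-]; apply/h; exists (a *: s + t).
by rewrite linearP.
Qed.

Lemma generates_mem (V : lmodType R) (T : choiceType) (g : T -> V) B k :
  generates g B -> B (g k).
Proof. by move=> h; apply/h; exists << k >>; rewrite extU scale1r. Qed.

Lemma fg_free r (N : {malg R['I_r]} -> Prop) : submod N -> fg N.
Proof.
move=> hN; apply: (@fg_sub _ [seq << i >> | i <- enum 'I_r]) => // u _.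
rewrite [u]monalgE; apply: submod_sum; first exact: span_submod.
move=> i; have -> : << u@_i *g i >> = u@_i *: << i >> :> {malg R['I_r]}.
  by apply/malgP => k; rewrite mcoeffZ !mcoeffU mulrnAr mulr1.
apply: submodZ; first exact: span_submod.
by apply/span_mem/map_f; rewrite mem_enum.
Qed.

Variable m : R -> Prop.
Hypothesis primem : isprime m.
Hypothesis unit_notin : forall u, ~ m u -> exists v, v * u = 1.

(** For the least number of generators, a relation with a unit coefficient would express one
    generator by the others. *)
Lemma minimal_generators (V : lmodType R) (B : V -> Prop) : fg B ->
  exists r (g : 'I_r -> V), generates g B /\
    forall u, ext g u = 0 -> forall i, m u@_i.
Proof.
move=> /fg_generates hB.
pose S r := `[< exists g : 'I_r -> V, generates g B >].
have exS : exists r, S r by have [r [g hg]] := hB; exists r; apply/asboolP; exists g.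
case: (ex_minnP exS) => r /asboolP [g hg] hmin; exists r, g; split=> // u hu i.
apply: contrapT => /unit_notin [a ha].
case: r g hg hmin u hu i ha => [|r] g hg hmin u hu i ha; first by case: i ha.
suff /hmin : S r by rewrite ltnn.
apply/asboolP; exists (fun j => g (lift i j)) => v; split=> [/hg [w hw]|[w <-]]; last first.
  rewrite ext_fin; apply: submod_sum; first exact: generates_submod hg.
  by move=> j; apply: submodZ; [exact: generates_submod hg | exact: (generates_mem _ hg)].
pose w' := w - (w@_i * a) *: u.
have ew' : ext g w' = v by rewrite linearB linearZ /= hu scaler0 subr0.
exists (\sum_j << w'@_(lift i j) *g j >>); rewrite linear_sum -ew' ext_fin.
rewrite (bigD1_ord i) //= mcoeffB mcoeffZ -mulrA ha mulr1 subrr scale0r add0r.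
by apply: eq_bigr => j _; rewrite extU.
Qed.

Variables (d : nat) (y : nat -> R).
Hypothesis my : forall r, m r <-> idl y d r.

(** Descending induction on [j = d - k]: a relation modulo the first [j] parameters has coefficients
    in [idl y j]. Minimality is the case [j = d]. In the step, the coefficients are [y j] times
    those of some [w], and [w] is again a relation because [y j] is regular on [B]; Nakayama then
    applies to the ideal of all such coefficients. *)
Lemma regular_free (V : lmodType R) (B : V -> Prop) r (g : 'I_r -> V) :
  generates g B -> (forall u, ext g u = 0 -> forall i, m u@_i) ->
  wreg y d B -> forall u, ext g u = 0 -> u = 0.
Proof.
move=> hg hmin hreg; have hB := generates_submod hg.
suff main k : (k <= d)%N -> forall u, inI y (d - k) B (ext g u) ->
    forall i, idl y (d - k) u@_i.
  move=> u hu; apply/malgP => i; rewrite mcoeff0.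
  by have := main d (leqnn d) u; rewrite subnn; apply.
elim: k => [|k IH] hk u.
  rewrite subn0 => hu i.
  have [|w hw ew] := inI_lift (q := ext g) (A := fun=> True) _ hu.
    by move=> w /hg [v <-]; exists v.
  have : m (u - w)@_i by apply: hmin; rewrite linearB /= ew subrr.
  rewrite mcoeffB => /my h; apply: (ideal_subr (ideal_idl y d)) h.
  by move/inI_coord: hw.
set j := (d - k.+1)%N; have ej : (d - k)%N = j.+1 by rewrite subnSK.
have hj : (j < d)%N by rewrite -ej leq_subr.
have sI := inI_submod y j hB.
move=> hu i; pose L a := exists2 u, inI y j B (ext g u) & u@_i = a.
have : L u@_i by exists u.
move: (u@_i) => {hu}a; apply: (nakayama noethR primem unit_notin (x := y j)).
- apply: idealP.
  + by exists 0; rewrite ?mcoeff0 // linear0; apply: submod0.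
  + move=> a' b [v hv <-] [w hw <-]; exists (v + w); rewrite ?mcoeffD // linearD.
    exact: submodD.
  + move=> a' b [v hv <-]; exists (a' *: v); rewrite ?mcoeffZ // linearZ.
    exact: submodZ.
- exact: ideal_idl.
- exact/my/idl_mem.
move=> _ [v hv <-].
have hc k' : exists c, idl y j (v@_k' - y j * c).
  by apply/idlS; rewrite -ej; apply: IH; [exact: ltnW | rewrite ej; apply: inI_S].
have [c {}hc] := choice hc.
pose w := \sum_k' << c k' *g k' >> : {malg R['I_r]}.
have ew k' : w@_k' = c k'.
  rewrite /w raddf_sum /= (bigD1 k') //= mcoeffUU big1 ?addr0 // => l hl.
  by rewrite mcoeffU (negPf hl).
exists (w@_i); last by rewrite ew; apply: hc.
exists w => //; apply: hreg => //; first by apply/hg; exists w.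
have : inI y j B (ext g (v - y j *: w)).
  apply: (inI_morph (f := ext g) (B := fun=> True)).
    by move=> s _; apply/hg; exists s.
  by apply/inI_coord => k'; rewrite mcoeffB mcoeffZ ew.
rewrite linearB linearZ /= => h.
have -> : y j *: ext g w = ext g v - (ext g v - y j *: ext g w) by rewrite opprB addrCA subrr addr0.
exact: submodB.
Qed.

End FinitelyGenerated.

(** * Free resolutions and global dimension *)

Section WellOrder.

Lemma exists_well_order (X : eqType) : exists lt : rel X,
  [/\ irreflexive lt, transitive lt, forall x y, x != y -> lt x y || lt y x
    & forall P : X -> Prop, (forall x, (forall y, lt y x -> P y) -> P x) -> forall x, P x].
Proof.
have [le hle] := well_ordering_principle X.
have wc : wo_chain le predT by apply: withinW.
have tot x y : le x y || le y x by apply: (wo_chainW wc).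
have anti x y : le x y -> le y x -> x = y.
  by move=> h1 h2; apply: (wo_chain_antisymmetric wc) => //; rewrite h1.
have refl x : le x x by have := tot x x; rewrite orbb.
exists (fun x y => ~~ le y x); split.
- by move=> x; rewrite refl.
- move=> y x z hxy hyz; apply/negP => hzx.
  have [|w [[+ hw] _]] := hle [mem [:: x; y; z]]; first by exists x; rewrite mem_head.
  rewrite !inE => /or3P [] /eqP ew; move: hw; rewrite ew => hw.
  + have exz : x = z by apply: anti => //; apply: hw; rewrite !inE eqxx !orbT.
    by move: hxy hyz (tot x y); rewrite exz => /negPf -> /negPf ->.
  + by move: hxy; rewrite hw // !inE eqxx.
  + by move: hyz; rewrite hw // !inE eqxx orbT.
- move=> x y hxy; rewrite -negb_and; apply: contra hxy => /andP [h1 h2].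
  by apply/eqP/anti.
- move=> P hP x; apply: contrapT => hx.
  have [|w [[hw hmin] _]] := hle [pred z | ~~ `[< P z >]].
    by exists x; apply/asboolPn.
  move: hw; rewrite inE => /asboolPn; apply; apply: hP => y.
  by move=> hyw; apply: contrapT => hy; case/negP: hyw; apply: hmin; apply/asboolPn.
Qed.

Lemma exists_max (X : eqType) (lt : rel X) (s : seq X) : transitive lt ->
  (forall x y, x != y -> lt x y || lt y x) ->
  s = [::] \/ exists2 x, x \in s & forall y, y \in s -> y = x \/ lt y x.
Proof.
move=> tr tot; elim: s => [|x s [->|[z hz hmax]]]; first by left.
  by right; exists x; [exact: mem_head | move=> y; rewrite inE => /eqP; left].
right; have [->|hxz] := eqVneq x z.
  by exists z; [exact: mem_head | move=> y; rewrite inE => /orP [/eqP|/hmax]; [left|]].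
case/orP: (tot _ _ hxz) => h.
  exists z; first by rewrite inE hz orbT.
  by move=> y; rewrite inE => /orP [/eqP ->|/hmax //]; right.
exists x; first exact: mem_head.
move=> y; rewrite inE => /orP [/eqP|/hmax [->|/tr /(_ h)]]; by [left | right].
Qed.

End WellOrder.

Section Resolutions.
Local Open Scope ring_scope.
Variable R : comNzRingType.

(* For submodules [A] and [B] of [V] with [A] contained in [B]: the module [B / A]
   has a free resolution with at most [n] nonzero terms. *)
Fixpoint relres (n : nat) : forall V : lmodType R, (V -> Prop) -> (V -> Prop) -> Prop :=
  match n with
  | 0 => fun V A B => forall v, B v -> A v
  | k.+1 => fun V A B => exists (T : choiceType) (g : T -> V),
      (forall v, B v <-> exists u, A (v - ext g u)) /\
      relres k (fun u : {malg R[T]} => u = 0) (fun u => A (ext g u))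
  end.

Definition freeres n (V : lmodType R) (B : V -> Prop) := relres n (fun v => v = 0) B.

(** Here [f] induces an isomorphism of B/A with [L]. Only the first generators need lifting; the
    syzygy they leave is literally the same. *)
Lemma relres_transfer n (W V : lmodType R) (f : {linear W -> V}) (A B : W -> Prop)
    (L : V -> Prop) : submod B -> submod A ->
  (forall w, A w -> B w) -> (forall v, L v <-> exists2 w, B w & f w = v) ->
  (forall w, B w -> A w <-> f w = 0) -> freeres n L -> relres n A B.
Proof.
case: n => [|n] hB hA hAB hL hf /=.
  move=> h0 w hw; apply/(hf _ hw)/h0; apply/hL; by exists w.
move=> [T [h [hh hres]]].
have hk t : exists w, B w /\ f w = h t.
  have /hL [w hw e] : L (h t) by apply/hh; exists << t >>; rewrite extU scale1r subrr.
  by exists w.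
have {hk} [k hk] := choice hk; exists T, k.
have Bk u : B (ext k u).
  by apply: submod_sum => // t; apply: submodZ => //; case: (hk t).
have fk u : f (ext k u) = ext h u.
  by rewrite linear_sum; apply: eq_bigr => t _; rewrite linearZ /=; case: (hk t) => _ ->.
split=> [w|]; last first.
  have -> // : (fun u => A (ext k u)) = (fun u => ext h u = 0).
  by apply/funext => u; apply/propext; rewrite -fk; apply: hf.
split=> [hw|[u /hAB]]; last by apply: submod_subr.
have /hh [u hu] : L (f w) by apply/hL; exists w.
exists u; apply/hf; first exact: submodB.
by rewrite linearB /= fk.
Qed.

Lemma coef_ext (S T : choiceType) (g : S -> {malg R[T]}) u k s :
  (forall l, (g l)@_k = (l == s)%:R) -> (ext g u)@_k = u@_s.
Proof.
move=> hg; rewrite raddf_sum /=.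
transitivity (\sum_(l <- msupp u) (<< u@_l *g l >> : {malg R[S]})@_s).
  apply: eq_bigr => l _; rewrite mcoeffZ hg mcoeffU.
  by case: (l == s); rewrite ?mulr1 ?mulr0.
by rewrite -raddf_sum -monalgE.
Qed.

Section Filtration.
Variables (X : choiceType) (lt : rel X).
Hypothesis ltxx : irreflexive lt.
Hypothesis lt_tr : transitive lt.
Hypothesis lt_tot : forall x y, x != y -> lt x y || lt y x.
Hypothesis lt_ind : forall P : X -> Prop,
  (forall x, (forall y, lt y x -> P y) -> P x) -> forall x, P x.

(** The case [v = 0] matters for the least [x], where the union of the earlier steps is empty. *)
Definition below (V : lmodType R) (F : X -> V -> Prop) (x : X) (v : V) : Prop :=
  v = 0 \/ exists2 y, lt y x & F y v.

Section Support.
Variables (K : choiceType) (tg : K -> X).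

Lemma support_below x (u : {malg R[K]}) : (forall k, u@_k != 0 -> lt (tg k) x) ->
  u = 0 \/ exists2 y, lt y x & forall k, u@_k != 0 -> tg k = y \/ lt (tg k) y.
Proof.
move=> hu; have [hs|[y hy hmax]] := exists_max [seq tg k | k <- msupp u] lt_tr lt_tot.
  left; apply/malgP => k; rewrite mcoeff0; apply/eqP; rewrite mcoeff_eq0; apply/negP => hk.
  by have := map_f tg hk; rewrite hs in_nil.
right; exists y.
  by case/mapP: hy => k; rewrite -mcoeff_neq0 => /hu h ->.
by move=> k hk; apply: hmax; apply/mapP; exists k => //; rewrite -mcoeff_neq0.
Qed.

Lemma support_bounded (u : {malg R[K]}) (x0 : X) :
  exists x, forall k, u@_k != 0 -> tg k = x \/ lt (tg k) x.
Proof.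
have [hs|[y hy hmax]] := exists_max [seq tg k | k <- msupp u] lt_tr lt_tot.
  exists x0 => k; rewrite mcoeff_neq0 => hk.
  by have := map_f tg hk; rewrite hs in_nil.
exists y => k hk; apply: hmax; apply/mapP; exists k => //.
by rewrite -mcoeff_neq0.
Qed.

Lemma support_submod x :
  submod (fun u : {malg R[K]} => forall k, u@_k != 0 -> tg k = x \/ lt (tg k) x).
Proof.
split; first by move=> k; rewrite mcoeff0 eqxx.
move=> a u v hu hv k; rewrite mcoeffD mcoeffZ.
have [e|/hu //] := eqVneq u@_k 0; have [e'|/hv //] := eqVneq v@_k 0.
by rewrite e e' mulr0 addr0 eqxx.
Qed.

End Support.

Section Below.
Variables (V : lmodType R) (F : X -> V -> Prop).
Hypothesis subF : forall x, submod (F x).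
Hypothesis monoF : forall x y v, lt y x -> F y v -> F x v.

Lemma below_submod x : submod (below F x).
Proof.
split; first by left.
move=> a u v [->|[y hy hu]] [->|[z hz hv]].
- by left; rewrite scaler0 addr0.
- by right; exists z; rewrite // scaler0 add0r.
- by right; exists y; rewrite // addr0; apply: submodZ.
- right; have [e|hyz] := eqVneq y z.
    by exists z => //; apply: (proj2 (subF z)) => //; rewrite -e.
  case/orP: (lt_tot hyz) => h.
    by exists z => //; apply: (proj2 (subF z)) => //; apply: monoF hu.
  by exists y => //; apply: (proj2 (subF y)) => //; apply: monoF hv.
Qed.

End Below.

Section Cover.
Variables (V : lmodType R) (F : X -> V -> Prop).
Hypothesis subF : forall x, submod (F x).
Hypothesis monoF : forall x y v, lt y x -> F y v -> F x v.
Variables (T : X -> choiceType) (g : forall x, T x -> V).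
Hypothesis coverF : forall x v, F x v <-> exists u, below F x (v - ext (@g x) u).

Let TT : choiceType := {x : X & T x}.
Let G (k : TT) : V := g (tagged k).

Let supple x (u : {malg R[TT]}) := forall k, u@_k != 0 -> tag k = x \/ lt (tag k) x.

(** [ext G] starts from the free module on all generators chosen for all quotients; its kernel is
    filtered by support. *)
Definition kerfil x u := ext G u = 0 /\ supple x u.

Let inj x : {malg R[T x]} -> {malg R[TT]} := ext (fun t => << Tagged T t >>).
Let res x : {malg R[TT]} -> {malg R[T x]} :=
  ext (fun k => untag 0 (fun t : T x => << t >> : {malg R[T x]}) k).

Lemma inj_coef x w t : (inj w)@_(Tagged T (t : T x)) = w@_t.
Proof. by apply: coef_ext => l; rewrite mcoeffU eq_Tagged. Qed.

Lemma inj_out x (w : {malg R[T x]}) k : tag k != x -> (inj w)@_k = 0.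
Proof.
move=> hk; rewrite raddf_sum big1 //= => t _; rewrite mcoeffZ mcoeffU.
by case: eqP => [e|]; rewrite ?mulr0 //; rewrite -e eqxx in hk.
Qed.

Lemma res_coef x u (t : T x) : (res x u)@_t = u@_(Tagged T t).
Proof.
apply: coef_ext => -[y s]; have [e|hy] := eqVneq y x.
  by case: x / e t => t; rewrite untagE mcoeffU eq_Tagged.
rewrite untag_dflt // mcoeff0; case: eqP => // e.
by case/eqP: hy; apply: (congr1 tag e).
Qed.

Lemma ext_inj x (w : {malg R[T x]}) : ext G (inj w) = ext (@g x) w.
Proof.
rewrite linear_ext; apply: eq_bigr => t _.
by rewrite /= extU scale1r.
Qed.

Lemma gF x t : F x (@g x t).
Proof. by apply/coverF; exists << t >>; left; rewrite extU scale1r subrr. Qed.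

Lemma supple_mono x y u : lt y x -> supple y u -> supple x u.
Proof.
by move=> hyx hu k /hu [->|h]; right => //; apply: lt_tr hyx.
Qed.

Lemma supple_submod x : submod (supple x).
Proof. exact: support_submod. Qed.

Lemma supple_ext x u : supple x u -> F x (ext G u).
Proof.
move=> hu; rewrite /ext big_seq; elim/big_ind: _ => [|v w|k hk].
- exact: submod0.
- exact: submodD.
apply: submodZ => //; rewrite -mcoeff_neq0 in hk.
case: (hu _ hk) => [e|h]; first by rewrite -e; apply: gF.
by apply: monoF h _; apply: gF.
Qed.

Lemma cover_surj x v : F x v -> exists2 u, supple x u & ext G u = v.
Proof.
elim/lt_ind: x v => x IH v /coverF [w hw].
have hinj : supple x (inj w).
  by move=> k hk; left; apply/eqP; apply: contraR hk => /inj_out ->.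
case: hw => [/eqP|[y hyx /(IH _ hyx) [u hu e]]].
  by rewrite subr_eq0 => /eqP ->; exists (inj w); rewrite ?ext_inj.
exists (inj w + u); last by rewrite linearD /= ext_inj e addrC subrK.
by apply: (submodD (supple_submod x) hinj); apply: supple_mono hu.
Qed.

Lemma kerfil_submod x : submod (kerfil x).
Proof.
have [h0 hS] := supple_submod x; split; first by split; rewrite ?linear0.
move=> a u v [hu hu'] [hv hv']; split; last exact: hS.
by rewrite linearP /= hu hv scaler0 addr0.
Qed.

Lemma kerfil_mono x y u : lt y x -> kerfil y u -> kerfil x u.
Proof. by move=> h [h1 /(supple_mono h)]. Qed.

Lemma supple_rest x u : supple x u ->
  u - inj (res x u) = 0 \/ exists2 y, lt y x & supple y (u - inj (res x u)).
Proof.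
move=> hu; apply: support_below => k; rewrite mcoeffB.
have [e|hk] := eqVneq (tag k) x.
  case: k e => y t /= e; case: x / e hu => hu.
  by rewrite inj_coef res_coef subrr eqxx.
by rewrite inj_out // subr0 => /hu [e|//]; rewrite e eqxx in hk.
Qed.

Lemma res_inj x w : res x (inj w) = w.
Proof. by apply/malgP => t; rewrite res_coef inj_coef. Qed.

Lemma res_below x y u : lt y x -> supple y u -> res x u = 0.
Proof.
move=> hyx hu; apply/malgP => t; rewrite res_coef mcoeff0.
apply/eqP; apply: contraT => /hu /= [e|h]; first by move: hyx; rewrite e ltxx.
by have := lt_tr h hyx; rewrite ltxx.
Qed.

(** Transfinite horseshoe lemma: the projection [res x] to the coordinates over [x] identifies the
    quotient of the kernel filtration at [x] with the syzygy of the quotient of [F] at [x].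
    Surjectivity corrects a lift [inj w] by an element of earlier support with the same image. *)
Lemma cover_relres n x :
  freeres n (fun u => below F x (ext (@g x) u)) ->
  relres n (fun u => u = 0 \/ exists2 y, lt y x & kerfil y u) (kerfil x).
Proof.
have sA : submod (fun u => u = 0 \/ exists2 y, lt y x & kerfil y u).
  exact: below_submod kerfil_submod kerfil_mono x.
apply: (@relres_transfer n _ _ (res x)) => //.
- exact: kerfil_submod.
- by move=> u [->|[y h]]; [exact: submod0 (kerfil_submod x) | exact: kerfil_mono].
- move=> w; split=> [[h0|[y hyx /cover_surj [u hu e]]]|[u [hu hux] <-]].
  + exists (inj w); last exact: res_inj.
    by split; rewrite ?ext_inj // => k hk; left; apply/eqP; apply: contraR hk => /inj_out ->.
  + exists (inj w - u); last first.
      transitivity (res x (inj w) - res x u); first exact: linearB.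
      by rewrite res_inj (res_below hyx) ?subr0.
    split; first by rewrite linearB /= ext_inj e subrr.
    apply: (submodB (supple_submod x)); last exact: supple_mono hu.
    by move=> k hk; left; apply/eqP; apply: contraR hk => /inj_out ->.
  + have -> : ext (@g x) (res x u) = - ext G (u - inj (res x u)).
      by rewrite linearB /= hu ext_inj sub0r opprK.
    apply: submodN; first exact: below_submod subF monoF x.
    case: (supple_rest hux) => [->|[y hy h]]; first by left; rewrite linear0.
    by right; exists y => //; apply: supple_ext.
- move=> u [hu hux]; split=> [[->|[y hy [_ h]]]|h0]; rewrite ?linear0 //.
    exact: res_below h.
  have e0 : inj (res x u) = 0 by rewrite (h0 : res x u = 0); apply: linear0.
  have := supple_rest hux; rewrite e0 subr0 => -[->|[y hy h]]; [by left|].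
  by right; exists y.
Qed.

Lemma ker_kerfil (u : {malg R[TT]}) (x0 : X) : ext G u = 0 <-> exists x, kerfil x u.
Proof.
split=> [hu|[x []] //]; have [x hx] := support_bounded (@tag X T) u x0.
by exists x.
Qed.

Lemma cover_image v (x0 : X) : (exists x, F x v) <-> exists u, ext G u = v.
Proof.
split=> [[x /cover_surj [u _ e]]|[u <-]]; first by exists u.
by have [x hx] := support_bounded (@tag X T) u x0; exists x; apply: supple_ext.
Qed.

End Cover.

(** Induction on [n]: generators of the quotients assemble into generators of the union, and the
    kernel carries a filtration whose quotients are resolved by one term less. For [n = 0] each step
    equals the union of the earlier ones, so all vanish by well-founded induction. *)
Lemma freeres_filtered n (V : lmodType R) (F : X -> V -> Prop) (x0 : X) :
  (forall x, submod (F x)) -> (forall x y v, lt y x -> F y v -> F x v) ->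
  (forall x, relres n (below F x) (F x)) -> freeres n (fun v => exists x, F x v).
Proof.
elim: n V F => [|n IH] V F subF monoF hF.
  move=> v [x]; elim/lt_ind: x v => x IHx v /hF [//|[y hy /(IHx _ hy)]] //.
have hT x : exists S : {T : choiceType & T -> V},
    (forall v, F x v <-> exists u, below F x (v - ext (projT2 S) u)) /\
    freeres n (fun u => below F x (ext (projT2 S) u)).
  by have [T [g hg]] := hF x; exists (existT _ T g).
have {hT} [S hS] := choice hT.
pose T x := projT1 (S x); pose g x : T x -> V := projT2 (S x).
have cov x v : F x v <-> exists u, below F x (v - ext (@g x) u) by case: (hS x).
exists {x : X & T x}, (fun k => @g (tag k) (tagged k)); split=> [v|].
  rewrite (cover_image subF monoF cov _ x0); split=> [[u <-]|[u hu]]; exists u.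
    by rewrite subrr.
  by apply/eqP; rewrite eq_sym -subr_eq0; apply/eqP.
have -> : (fun u => ext (fun k : {x : X & T x} => @g (tag k) (tagged k)) u = 0) =
    (fun u => exists x, kerfil g x u).
  by apply/funext => u; apply/propext; apply: ker_kerfil.
apply: IH => x.
- exact: kerfil_submod.
- by move=> y v; apply: kerfil_mono.
- by apply: cover_relres => //; case: (hS x).
Qed.

End Filtration.
End Resolutions.

(** * The upper bound on the global dimension *)

Section GlobalDimension.
Local Open Scope ring_scope.
Variable R : comNzRingType.

(* Auslander's reduction of the global dimension to ideals: the submodules spanned by
   the initial segments of a well-ordering of the module form a filtration with
   cyclic quotients. *)
Lemma freeres_of_ideals n (V : lmodType R) :
  (forall I : R -> Prop, ideal I -> @freeres R n R^o I) -> freeres n.+1 (fun _ : V => True).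
Proof.
move=> hI; have [lt [ltxx lt_tr lt_tot lt_ind]] := exists_well_order V.
pose le x u := forall k : V, (u : {malg R[V]})@_k != 0 -> k = x \/ lt k x.
have sle x : submod (le x) by exact: (@support_submod R V lt V id x).
pose F x v := exists2 u, le x u & ext id u = v.
have sF x : submod (F x).
  split; first by exists 0; rewrite ?linear0 //; apply: submod0.
  move=> a u v [s hs <-] [t ht <-]; exists (a *: s + t); last by rewrite linearP.
  by apply: (proj2 (sle x)).
have mF x y v : lt y x -> F y v -> F x v.
  move=> hyx [u hu <-]; exists u => // k /hu [->|h]; right => //.
  exact: lt_tr hyx.
have := @freeres_filtered R V lt ltxx lt_tr lt_tot lt_ind n.+1 V F 0 sF mF.
have -> : (fun v => exists x, F x v) = (fun=> True).
  apply/funext => v; apply/propext; split=> // _; exists v, << v >>.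
    by move=> k; rewrite mcoeffU; have [e|_] := eqVneq v k; [left | rewrite eqxx].
  by rewrite extU scale1r.
apply => x.
have sb : submod (below lt F x) by apply: below_submod.
have eg w : ext (fun=> x) w = w@_tt *: x :> V.
  by rewrite ext_fin (bigD1 tt) //= big1 ?addr0 // => -[].
have Fx a : F x (a *: x).
  exists << a *g x >>; last by rewrite extU.
  by move=> k; rewrite mcoeffU; have [e|_] := eqVneq x k; [left | rewrite eqxx].
exists unit, (fun=> x); split=> [v|].
  split=> [[u hu <-]|[w]].
    exists << u@_x *g tt >>; rewrite eg mcoeffUU.
    have e' : ext id u - u@_x *: x = ext id (u - << u@_x *g x >>).
      by rewrite linearB /= extU.
    rewrite e'; case: (@support_below R V lt lt_tr lt_tot V id x (u - << u@_x *g x >>)) => [k|e0|[y hy h]].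
    - rewrite mcoeffB mcoeffU; have [->|hk] := eqVneq x k.
        by rewrite subrr eqxx.
      by rewrite subr0 => /hu [e|//]; rewrite e eqxx in hk.
    - by left; rewrite e0 linear0.
    - by right; exists y => //; exists (u - << u@_x *g x >>).
  rewrite eg => -[/eqP|[y hy /(mF _ _ _ hy)]].
    by rewrite subr_eq0 => /eqP ->.
  by apply: submod_subr => //; exact: Fx.
(* The quotient at [x] is generated by [x]; this ideal is its annihilator, hence its first
   syzygy. *)
have hid : ideal (fun a => below lt F x (a *: x)).
  apply: idealP; first by left; rewrite scale0r.
    by move=> a b ha hb; rewrite scalerDl; apply: submodD.
  by move=> a b hb; rewrite -scalerA; apply: submodZ.
apply: (relres_transfer (f := @coord R unit tt)) (hI _ hid).
- split; first by rewrite linear0; left.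
  by move=> a u v hu hv; rewrite linearP; apply: (proj2 sb).
- by split=> // a u v -> ->; rewrite scaler0 addr0.
- by move=> w ->; rewrite linear0; left.
- move=> a; split=> [ha|[w]]; last by rewrite eg => h <-.
  by exists << a *g tt >>; [rewrite eg mcoeffUU | exact: mcoeffUU].
- move=> w _; split=> [->|h]; first by rewrite linear0.
  by apply/malgP => -[]; rewrite mcoeff0.
Qed.

Lemma freeres_sequence n (V : lmodType R) (B : V -> Prop) : submod B -> freeres n B ->
  exists (T : nat -> choiceType) (g0 : T 0%N -> V) (g : forall i, T i.+1 -> {malg R[T i]}),
  [/\ forall v, B v <-> exists u, ext g0 u = v,
      forall u, ext g0 u = 0 <-> exists w, ext (@g 0%N) w = u,
      forall i u, ext (@g i) u = 0 <-> exists w, ext (@g i.+1) w = u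
    & forall i, (n <= i)%N -> T i -> False].
Proof.
elim: n V B => [|n IH] V B hB.
  have v0 (W : lmodType R) (g : void -> W) u : ext g u = 0.
    by rewrite ext_fin big1 // => -[].
  have m0 (u : {malg R[void]}) : u = 0 by apply/malgP => -[].
  move=> h; exists (fun=> void), (fun e => of_void V e), (fun _ e => of_void _ e).
  split=> [v|u|i u|//]; rewrite ?v0.
  - split=> [/h ->|[u <-]]; first by exists 0; rewrite v0.
    by rewrite v0; apply: submod0.
  - by split=> // _; exists 0; rewrite [RHS]m0 linear0.
  - by split=> // _; exists 0; rewrite [RHS]m0 linear0.
move=> [T [g [hg /IH]]].
case=> [|T' [g0 [g' [h1 h2 h3 h4]]]].
  split; first by rewrite linear0.
  by move=> a u v hu hv; rewrite linearP /= hu hv scaler0 addr0.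
pose S i := if i is j.+1 then T' j else T.
pose G i : S i.+1 -> {malg R[S i]} := match i with 0 => g0 | j.+1 => @g' j end.
exists S, g, G; split=> [v|u|[|i] u|[|i] //].
- split=> [/hg [u hu]|[u <-]]; last by apply/hg; exists u; rewrite subrr.
  by exists u; apply/eqP; rewrite eq_sym -subr_eq0; apply/eqP.
- exact: h1.
- exact: h2.
- exact: h3.
- by rewrite ltnS; apply: h4.
Qed.

Lemma projdim_of_freeres n (V : lmodType R) : freeres n.+1 (fun _ : V => True) -> projdim_le V n.
Proof.
move=> h; have [T [g0 [g [h1 h2 h3 h4]]]] := freeres_sequence (submod_full V) h.
exists (fun i => {malg R[T i]}), (fun i => ext (@g i)), (ext g0); split.
  split=> [i|i|u|v]; [exact: malg_projective | exact: h3 | exact: h2 | exact/h1].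
by move=> i hi u; apply/malgP => t; case: (h4 i hi t).
Qed.

Hypothesis noethR : noetherian R.
Variable m : R -> Prop.
Hypothesis primem : isprime m.
Hypothesis unit_notin : forall u, ~ m u -> exists v, v * u = 1.
Variables (d : nat) (y : nat -> R).
Hypothesis my : forall r, m r <-> idl y d r.
Hypothesis regy : forall i r, (i < d)%N -> idl y i (y i * r) -> idl y i r.

Lemma ker_submod (V W : lmodType R) (f : {linear V -> W}) : submod (fun u => f u = 0).
Proof.
split; first by rewrite linear0.
by move=> a u v hu hv; rewrite linearP hu hv scaler0 addr0.
Qed.

(** Each syzygy is regular for one more parameter, and at all [d] of them minimal generators are
    free. *)
Lemma fg_freeres k (V : lmodType R) (B : V -> Prop) : (k <= d)%N -> fg B ->
  wreg y (d - k) B -> freeres k.+1 B.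
Proof.
elim: k V B => [|k IH] V B hk hB hreg.
  have [r [g [hg hmin]]] := minimal_generators unit_notin hB.
  exists 'I_r, g; split=> [v|u hu].
    rewrite hg; split=> [[u <-]|[u /eqP]]; exists u; first by rewrite subrr.
    by apply/eqP; rewrite eq_sym -subr_eq0.
  rewrite subn0 in hreg.
  exact: (regular_free noethR primem unit_notin my hg hmin hreg).
have [r [g hg]] := fg_generates hB.
exists 'I_r, g; split=> [v|].
  rewrite hg; split=> [[u <-]|[u /eqP]]; exists u; first by rewrite subrr.
  by apply/eqP; rewrite eq_sym -subr_eq0.
apply: (IH _ (fun u => ext g u = 0)); first exact: ltnW.
  by apply: (fg_free noethR); apply: (ker_submod (ext g)).
apply: (wreg_ker (q := ext g) hg (j := (d - k.+1)%N)) => //.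
  by rewrite subnSK.
by apply: (wreg_le (leq_subr k d)); apply: wreg_free.
Qed.

Lemma projdim_le_parameters (V : lmodType R) : (0 < d)%N -> projdim_le V d.
Proof.
move=> d0; apply/projdim_of_freeres/freeres_of_ideals => I hI.
rewrite -(prednK d0); apply: fg_freeres; [exact: leq_pred | exact: ideal_fg |].
(* An ideal sits inside [R], so it is already regular for one parameter. This saves one term: [d]
   for ideals, [d.+1] for modules, in degrees 0 to [d]. *)
have -> : (d - d.-1 = 1)%N by rewrite -{1}(prednK d0) subSnn.
by move=> [|//] _ v _; apply: (regy d0).
Qed.

End GlobalDimension.

(** * Depth *)

Section Connecting.
Local Open Scope ring_scope.
Variable R : comNzRingType.

(* Elements of [B / (x_0, ..., x_(j-1)) B] killed by the first [h] of the [x_i] and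
   infinitely divisible by [s]; for [s = 1] this is just one nonzero such element. *)
Definition divisible_socle (x : nat -> R) h (s : R) j (V : lmodType R) (B : V -> Prop) :=
  exists z : nat -> V, [/\ forall k, B (z k),
    forall k, inI x j B (s *: z k.+1 - z k), ~ inI x j B (z 0%N)
    & forall k i, (i < h)%N -> inI x j B (x i *: z k)].

(* For [0 -> N -> P -> B -> 0], multiplication by [x_j] modulo [(x_0, ..., x_(j-1))]
   gives by the snake lemma an injection of the part of [B / (x_0, ..., x_(j-1)) B]
   killed by [x_j] into [N / (x_0, ..., x_j) N]; its graph is the relation [D]. *)
Lemma connecting_step (x : nat -> R) h s j (P V : lmodType R) (q : {linear P -> V})
    (B : V -> Prop) :
  (forall v, B v <-> exists u, q u = v) -> (j < h)%N ->
  wreg x j B -> wreg x j.+1 (fun _ : P => True) ->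
  divisible_socle x h s j B -> divisible_socle x h s j.+1 (fun u => q u = 0).
Proof.
move=> imq hj regB regP [z [Bz sz nz xz]].
have liftB w : B w -> exists2 v, True & q v = w by move=> /imq [v <-]; exists v.
have qB u : True -> B (q u) by move=> _; apply/imq; exists u.
have sN := ker_submod q; have sT := @inIT_submod R P x j.
pose D z v := q v = 0 /\ exists2 u, q u = z & inI x j (fun=> True) (x j *: u - v).
have D_total w : B w -> inI x j B (x j *: w) -> exists v, D w v.
  move=> /imq [u <-] /(inI_lift (A := fun=> True) liftB) [c hc ec].
  exists (x j *: u - c); split; first by rewrite linearB linearZ /= ec subrr.
  by exists u => //; rewrite opprB addrC subrK.
have D_lin a w v w' v' : D w v -> D w' v' -> D (a *: w + w') (a *: v + v').
  move=> [hv [u <- hu]] [hv' [u' <- hu']]; split.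
    by rewrite linearP /= hv hv' scaler0 addr0.
  exists (a *: u + u'); first by rewrite linearP.
  have -> : x j *: (a *: u + u') - (a *: v + v') = a *: (x j *: u - v) + (x j *: u' - v').
    by rewrite scalerDr scalerBr !scalerA [x j * a]mulrC opprD addrACA.
  exact: (proj2 sT).
have D_zero w v : D w v -> inI x j B w -> inI x j.+1 (fun u => q u = 0) v.
  move=> [hv [u <- hu]] /(inI_lift (A := fun=> True) liftB) [c hc ec].
  have huc : q (u - c) = 0 by rewrite linearB /= ec subrr.
  exists (u - c) => //; apply: (inI_ker imq) => //.
    by rewrite linearB linearZ /= huc hv scaler0 subrr.
  have -> : v - x j *: (u - c) = x j *: c - (x j *: u - v).
    by rewrite scalerBr !opprB addrCA.
  by apply: (submodB sT) => //; apply: (submodZ sT).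
have D_inj w v : D w v -> inI x j.+1 (fun u => q u = 0) v -> inI x j B w.
  move=> [hv [u <- hu]] [t ht hvt].
  have : inI x j (fun=> True) (u - t).
    apply: regP => //.
    have -> : x j *: (u - t) = (x j *: u - v) + (v - x j *: t).
      by rewrite scalerBr addrA subrK.
    by apply: (submodD sT) => //; apply: inI_mono hvt.
  by move=> /(inI_morph (f := q) qB); rewrite linearB /= ht subr0.
have D_scale a w v : D w v -> D (a *: w) (a *: v).
  move=> hwv; rewrite -[a *: w]addr0 -[a *: v]addr0; apply: D_lin => //.
  by split; [exact: linear0 | exists 0; [exact: linear0 | rewrite scaler0 subr0; exact: submod0 sT]].
have [v hv] := choice (fun k => D_total (z k) (Bz k) (xz k j hj)).
exists v; split=> [k|k|h0|k i hi].
- by case: (hv k).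
- apply: (D_zero (s *: z k.+1 - z k)) => //.
  rewrite addrC -scaleN1r [s *: v _ - _]addrC -[- v k]scaleN1r.
  by apply: D_lin => //; apply: D_scale.
- exact: nz (D_inj _ _ (hv 0%N) h0).
- by apply: (D_zero (x i *: z k)); [exact: D_scale | exact: xz].
Qed.

Hypothesis noethR : noetherian R.
Variable m : R -> Prop.
Hypothesis primem : isprime m.
Hypothesis unit_notin : forall u, ~ m u -> exists v, v * u = 1.
Variables (d : nat) (y : nat -> R).
Hypothesis d_gt0 : (0 < d)%N.
Hypothesis my : forall r, m r <-> idl y d r.
Hypothesis regy : forall i r, (i < d)%N -> idl y i (y i * r) -> idl y i r.

Section Depth.
Variables (h : nat) (x : nat -> R) (z : R).
Hypothesis lthd : (h < d)%N.
Hypothesis regx : forall i r, (i < h)%N -> idl x i (x i * r) -> idl x i r.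
Hypothesis mz : forall r, m r -> idl x h (r * z).

(* Descends a minimal free resolution of [R / m], started at its first syzygy [m]; the
   [d]-th syzygy is free, nonzero and contained in [m] times the preceding free module. *)
Lemma socle_syzygy k (V : lmodType R) (B : V -> Prop) : (k < d)%N -> fg B -> submod B ->
  wreg y (d - k) B -> wreg x (minn (d - k) h) B ->
  (k = 0%N -> forall b, B b -> inI x h (fun=> True) b -> inI x h B b) ->
  (forall b, B b -> inI x h (fun=> True) (z *: b)) ->
  divisible_socle y d 1 (d - k) B -> idl x h z.
Proof.
elim: k V B => [|k IH] V B hk fgB sB regyB regxB capB zB socB.
  have [r [g [hg hmin]]] := minimal_generators unit_notin fgB.
  rewrite subn0 in regyB socB.
  have gfree := regular_free noethR primem unit_notin my hg hmin regyB.
  case: r g hg hmin gfree => [|r] g hg hmin gfree.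
    case: socB => w [/(_ 0%N) /hg [u <-] _ nw _]; case: nw.
    have -> : u = 0 by apply/malgP => -[].
    by rewrite linear0; exact: submod0 (inI_submod _ _ sB).
  have Bg : B (g ord0) by apply: generates_mem hg.
  have liftB w : B w -> exists2 u, True & ext g u = w by move=> /hg [u <-]; exists u.
  (* The multiple of [g ord0] by [z] is in (x)F for the preceding free module F, hence in (x)B by
     [capB]. As [g] is a basis of [B], its coefficient [z] is in (x). *)
  have := capB erefl _ (submodZ sB z Bg) (zB _ Bg).
  move=> /(inI_lift (A := fun=> True) liftB) [w /inI_coord hw ew].
  have /gfree : ext g (w - << z *g ord0 >>) = 0 by rewrite linearB /= ew extU subrr.
  move/(congr1 (mcoeff ord0)); rewrite mcoeffB mcoeffUU mcoeff0 => /eqP.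
  by rewrite subr_eq0 => /eqP <-.
have [r [g [hg hmin]]] := minimal_generators unit_notin fgB.
have ej : (d - k)%N = (d - k.+1).+1 by rewrite subnSK // ltnW.
apply: (IH _ (fun u => ext g u = 0)) => //.
- exact: ltnW.
- exact: (fg_free noethR (ker_submod (ext g))).
- exact: (ker_submod (ext g)).
- apply: (wreg_ker (q := ext g) hg _ regyB); first by rewrite ej.
  by apply: (wreg_le (leq_subr k d)); apply: wreg_free.
- apply: (wreg_ker (q := ext g) hg _ regxB).
    by rewrite ej -minnSS leq_min geq_minl leqW // geq_minr.
  by apply: (wreg_le (geq_minr _ h)); apply: wreg_free.
(* Here [h < d] enters: the module before the last syzygy is regular for [d.-1] terms of [x], hence
   for all [h] of them. *)
- move=> k0 u hu; apply: (inI_ker (q := ext g) hg) => //.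
  apply: wreg_le regxB; rewrite leq_min leqnn andbT -ltnS -ej k0 subn0 //.
- move=> u hu; apply/inI_coord => i; rewrite mcoeffZ mulrC; apply: mz; exact: hmin.
- rewrite ej; apply: (connecting_step (q := ext g) hg) => //.
    by rewrite -ej leq_subr.
  by apply: (wreg_le (_ : (_ <= d)%N)); [rewrite -ej leq_subr | exact: wreg_free].
Qed.

(** For [h < d] the quotient R/(x) has zero socle. The descent starts at [m], the first syzygy of
    R/m, which is why [k] is [d.-1]. *)
Lemma socle_regular_quotient : idl x h z.
Proof.
case: (primem) => im m1 _.
apply: (@socle_syzygy d.-1 R^o m) => //.
- by rewrite ltn_predL.
- exact: ideal_fg.
all: rewrite ?subn_pred // -?subn1 ?subKn //.
- by move=> [|//] _ v _; apply: (regy d_gt0).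
- move=> [|i]; rewrite leq_min => /andP [hi1 hi] v _; last by rewrite ltnS ltn0 in hi1.
  exact: (regx hi).
- move=> hd1 b hb; have -> : h = 0%N by move: lthd hd1; case: d d_gt0 => [|[]] // _; case: h.
  by [].
- by move=> b hb; rewrite /GRing.scale /= mulrC; apply: mz.
(* The starting class is that of [y 0] in m/(y_0)m. Each [y i] kills it, as [y i * y 0] is [y 0]
   times an element of [m]. If it vanished, [y 0] would be zero, which contradicts its
   regularity. *)
- have y0 : m (y 0%N) by apply/my/idl_mem.
  exists (fun=> y 0%N); split=> //.
  + by move=> k; rewrite scale1r subrr; apply: submod0; apply: inI_submod.
  + move=> [b hb /eqP]; rewrite subr_eq0 => /eqP e.
    have : ~ m (1 - b).
      by move=> h1; apply: m1; rewrite -(subrK b 1); apply: (idealD im).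
    move=> /unit_notin [v hv].
    have y00 : y 0%N = 0.
      rewrite -[y 0%N]mul1r -hv -mulrA mulrBl mul1r {1}e /GRing.scale /= [b * _]mulrC subrr.
      by rewrite mulr0.
    apply: m1; have /= -> : idl y 0 1; last exact: ideal0.
    by apply: (regy d_gt0); rewrite y00 mul0r.
  + move=> _ i hi; exists (y i); first exact/my/idl_mem.
    by rewrite /GRing.scale /= [y 0%N * _]mulrC subrr.
Qed.

End Depth.
End Connecting.

(** * Zero divisors modulo an ideal, and prime avoidance *)

Section ZeroDivisors.
Local Open Scope ring_scope.
Variable R : comNzRingType.
Hypothesis noethR : noetherian R.
Variable I : R -> Prop.
Hypothesis idI : ideal I.

Definition maximal_ann w := ~ I w /\
  forall w', ~ I w' -> (forall r, ann I w r -> ann I w' r) -> forall r, ann I w' r -> ann I w r.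

Lemma maximal_ann_prime w : maximal_ann w -> isprime (ann I w).
Proof.
move=> [hw hmax]; apply: maxann_prime => // c hc r hr.
apply: (hmax (c * w)) => // s hs; rewrite /ann mulrCA; exact: idealM.
Qed.

Lemma below_maximal_ann z : ~ I z ->
  exists2 w, maximal_ann w & forall r, ann I z r -> ann I w r.
Proof.
move=> hz.
pose F J := exists w, [/\ ~ I w, forall r, ann I z r -> ann I w r & J = ann I w].
have hF J : F J -> ideal J by move=> [w [_ _ ->]]; apply: ann_ideal.
have [|_ [w [hw hzw ->]] hmax] := noeth_max noethR hF; first by exists (ann I z), z.
exists w => //; split=> // w' hw' hww'; apply: (hmax (ann I w')) => //.
by exists w'; split=> // r /hzw/hww'.
Qed.

Lemma avoid_ann w (s : seq R) : maximal_ann w ->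
  (forall w', w' \in s -> ~ forall r, ann I w' r -> ann I w r) ->
  exists2 c, ~ ann I w c & forall w', w' \in s -> ann I w' c.
Proof.
move=> /maximal_ann_prime [iw w1 pw]; elim: s => [|v s IH] hs; first by exists 1.
have [|c hc hcs] := IH; first by move=> w' h; apply: hs; rewrite inE h orbT.
have /existsNP [b /not_implyP [hb nb]] := hs v (mem_head _ _).
exists (b * c); first by move=> /pw [].
move=> w'; rewrite inE => /orP [/eqP ->|/hcs h].
  by rewrite mulrC; apply: (idealM (ann_ideal v idI)).
exact: (idealM (ann_ideal w' idI)).
Qed.

(* The maximal annihilators are finitely many: if the [w]'s in [s] generate, modulo
   [I], an ideal that no further [w] enlarges, every maximal annihilator is among
   those of [s]. *)
Lemma finite_maximal_ann : exists2 s : seq R, forall w, w \in s -> maximal_ann w &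
  forall w, maximal_ann w -> exists2 w', w' \in s & forall r, ann I w r -> ann I w' r.
Proof.
pose K (s : seq R) r := exists2 v, I v & @span R R^o s (r - v).
pose F J := exists2 s : seq R, (forall w, w \in s -> maximal_ann w) & J = K s.
have idK s : ideal (K s).
  apply: idealP.
  - by exists 0; [exact: ideal0 | rewrite subr0; exact: submod0 (span_submod _)].
  - move=> a b [v hv ha] [w hw hb]; exists (v + w); first exact: idealD.
    by rewrite opprD addrACA; apply: (submodD (span_submod _)).
  - move=> a b [v hv hb]; exists (a * v); first exact: idealM.
    by rewrite -mulrBr; apply: (submodZ (span_submod _)).
have hF J : F J -> ideal J by move=> [s _ ->].
have [|_ [s hs ->] hmax] := noeth_max noethR hF; first by exists (K [::]), [::].
exists s => // w hw; apply: contrapT => hno.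
have [|c hc hcs] := avoid_ann (s := s) hw.
  move=> w' hw' hsub; apply: hno; exists w' => // r.
  by case: (hs _ hw') => _ h; apply: h; case: hw.
have [v hv hspan] : K s w.
  apply: (hmax (K (w :: s))).
  - by exists (w :: s) => // w'; rewrite inE => /orP [/eqP ->|/hs].
  - move=> r [v hv h]; exists v => //; exists 0.
    by rewrite scale0r subr0.
  - exists 0; first exact: ideal0.
    by rewrite subr0; apply: span_mem; rewrite mem_head.
apply: hc; rewrite /ann.
have -> : c * w = c * v + c * (w - v) by rewrite mulrBr addrC subrK.
apply: idealD => //; first exact: idealM.
have sc : @submod R R^o (fun r => I (c * r)).
  apply: idealP; first by rewrite mulr0; apply: ideal0.
    by move=> a b ha hb; rewrite mulrDr; apply: idealD.
  by move=> a b hb; rewrite mulrCA; apply: idealM.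
exact: (span_sub sc hcs hspan).
Qed.

(** Prime avoidance: if no single [z] works, [J] lies in no maximal annihilator, and an element of
    [J] outside all the finitely many of them is built along the list. When [a] fails at a new [w],
    it is corrected by [c * b], with [c] in all earlier annihilators and neither factor in that of
    [w]. *)
Lemma common_zero_divisor (J : R -> Prop) : ideal J ->
  (forall x, J x -> exists2 z, ~ I z & I (x * z)) ->
  exists2 z, ~ I z & forall x, J x -> I (x * z).
Proof.
move=> idJ hJ; apply: contrapT => hno.
have [s hs hmax] := finite_maximal_ann.
have [a ha has] : exists2 a, J a & forall w, w \in s -> ~ ann I w a; last first.
  have [z hz haz] := hJ a ha; have [w hw hzw] := below_maximal_ann hz.
  have [w' hw' hww'] := hmax w hw.
  by apply: (has w') => //; apply/hww'/hzw.
elim: s hs {hmax} => [|w s IH] hs; first by exists 0; [exact: ideal0 |].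
have [|a ha has] := IH; first by move=> w' h; apply: hs; rewrite inE h orbT.
have hw := hs w (mem_head _ _).
have [haw|haw] := pselect (ann I w a); last first.
  by exists a => // w'; rewrite inE => /orP [/eqP ->|/has].
have [|c hc hcs] := avoid_ann (s := s) hw.
  move=> w' hw' hsub; apply: (has w' hw').
  have mw' : maximal_ann w' by apply: hs; rewrite inE hw' orbT.
  by case: (mw') => _ h; apply: (h w) => //; case: hw.
have [b hb hbw] : exists2 b, J b & ~ ann I w b.
  apply: contrapT => h; apply: hno; exists w; first by case: hw.
  by move=> x hx; apply: contrapT => hxw; apply: h; exists x.
have [iw w1 pw] := maximal_ann_prime hw.
exists (a + c * b); first by apply: (idealD idJ) => //; apply: (idealM idJ).
move=> w'; rewrite inE => /orP [/eqP ->|hw'] h.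
  have : ann I w (c * b) by apply: (submod_subr iw (v := - a)); rewrite ?opprK ?[c * b + a]addrC //; apply: (idealN iw).
  by case/pw.
apply: (has w' hw'); have iw' := ann_ideal w' idI.
apply: (submod_addr iw' (v := c * b)) => //.
by apply: (idealMl iw'); apply: hcs.
Qed.

End ZeroDivisors.

(** * A regular sequence inside the prime *)

Section Grade.
Local Open Scope ring_scope.
Variable R : comNzRingType.
Hypothesis noethR : noetherian R.
Variable m : R -> Prop.
Hypothesis primem : isprime m.
Hypothesis unit_notin : forall u, ~ m u -> exists v, v * u = 1.
Variables (d : nat) (y : nat -> R).
Hypothesis d_gt0 : (0 < d)%N.
Hypothesis my : forall r, m r <-> idl y d r.
Hypothesis regy : forall i r, (i < d)%N -> idl y i (y i * r) -> idl y i r.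
Variable p : R -> Prop.
Hypothesis primep : isprime p.
Hypothesis p_adjacent : forall Q, isprime Q -> (forall r, p r -> Q r) ->
  (exists2 a, Q a & ~ p a) -> forall r, m r -> Q r.

Lemma extend_regular h (x : nat -> R) t :
  (forall i r, (i < h)%N -> idl x i (x i * r) -> idl x i r) ->
  (forall r, idl x h (t * r) -> idl x h r) ->
  exists x', [/\ x' h = t, forall i, (i < h)%N -> x' i = x i, idl x' h = idl x h &
    forall i r, (i < h.+1)%N -> idl x' i (x' i * r) -> idl x' i r].
Proof.
move=> regx regt; pose x' i := if (i == h)%N then t else x i.
have lt i : (i < h)%N -> x' i = x i by rewrite /x' => hi; rewrite ltn_eqF.
have eq : x' h = t by rewrite /x' eqxx.
have ei i : (i <= h)%N -> idl x' i = idl x i.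
  move=> hi; apply/funext => r; apply/propext.
  by split; apply: inI_seq => j hj; rewrite lt //; apply: leq_trans hj hi.
exists x'; split=> //; first exact: ei.
move=> i r; rewrite ltnS leq_eqVlt => /orP [/eqP ->|hi]; first by rewrite eq ei //; apply: regt.
by rewrite ei 1?ltnW // lt //; apply: regx.
Qed.

(** Suppose no element of [p] prolongs [x]. Positive depth of R/(x) gives a regular [t] in [m],
    necessarily outside [p]. Some element killed by [p] modulo (x) survives modulo (x, t); a
    multiple of it has a prime annihilator containing [p] and [t], hence [m] by adjacency. That is a
    nonzero socle element of R/(x, t), although this quotient still has positive depth. *)
Lemma exists_regular (h : nat) : (h < d)%N -> exists2 x : nat -> R, forall i, (i < h)%N -> p (x i) &
  forall i r, (i < h)%N -> idl x i (x i * r) -> idl x i r.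
Proof.
elim: h => [|h IH] hd; first by exists (fun=> 0).
have [x px regx] := IH (ltnW hd).
have [iI ip] : ideal (idl x h) /\ ideal p by split; [exact: ideal_idl | case: primep].
have im : ideal m by case: primem.
have [[t pt regt]|hno] := pselect (exists2 t, p t & forall r, idl x h (t * r) -> idl x h r).
  have [x' [e1 e2 _ regx']] := extend_regular regx regt.
  exists x' => // i; rewrite ltnS leq_eqVlt => /orP [/eqP ->|hi]; first by rewrite e1.
  by rewrite e2 //; apply: px.
have [t mt regt] : exists2 t, m t & forall r, idl x h (t * r) -> idl x h r.
  apply: contrapT => hno'.
  have [|z hz mz] := common_zero_divisor noethR iI im.
    move=> t mt; apply: contrapT => h0; apply: hno'; exists t => // r hr.
    by apply: contrapT => hr'; apply: h0; exists r.
  by apply: hz; apply: (socle_regular_quotient noethR primem unit_notin d_gt0 my regy (ltnW hd)).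
have [|z hz pz] := common_zero_divisor noethR iI ip.
  move=> t' pt; apply: contrapT => h0; apply: hno; exists t' => // r hr.
  by apply: contrapT => hr'; apply: h0; exists r.
have [x' [e1 e2 e3 regx']] := extend_regular regx regt.
have pt : ~ p t by move=> /pz /regt.
pose J r := forall q, p q -> idl x h (q * r).
have iJ : ideal J.
  apply: idealP => [q _|a b ha hb q hq|a b hb q hq].
  - by rewrite mulr0; apply: ideal0.
  - by rewrite mulrDr; apply: (idealD iI); [apply: ha | apply: hb].
  - by rewrite mulrCA; apply: (idealM iI); apply: hb.
(* If [J] were inside (x, t), then J would lie in (x) + t J, since [t] is regular modulo (x);
   Nakayama would put [J], and with it [z], in (x). *)
have [z1 Jz1 nz1] : exists2 z1, J z1 & ~ idl x' h.+1 z1.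
  apply: contrapT => hJ; apply: hz.
  apply: (nakayama noethR primem unit_notin iJ iI mt) => // l Jl.
  have /idlS [c] : idl x' h.+1 l by apply: contrapT => hl; apply: hJ; exists l.
  rewrite e1 e3 => hc; exists c => // q pq; apply: regt.
  have -> : t * (q * c) = q * l - q * (l - t * c) by ring.
  by apply: (idealB iI); [apply: Jl | apply: (idealM iI)].
have iI' := ideal_idl x' h.+1.
have [c hc pQ] := exists_ann_prime noethR iI' nz1.
have mQ : forall r, m r -> ann (idl x' h.+1) (c * z1) r.
  apply: p_adjacent pQ _ _.
    move=> r pr; rewrite /ann mulrCA; apply: (idealM iI').
    by apply: inI_S => //; have := Jz1 r pr; rewrite -e3.
  exists t => //; rewrite /ann -e1; apply: (idealMl iI'); exact: idl_mem.
exfalso; apply: hc.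
exact: (socle_regular_quotient noethR primem unit_notin d_gt0 my regy hd regx' mQ).
Qed.

End Grade.

(** * The lower bound *)

Section LowerBound.
Local Open Scope ring_scope.
Variable R : comNzRingType.

Fixpoint projres (n : nat) : forall V : lmodType R, (V -> Prop) -> Prop :=
  match n with
  | 0 => fun V B => forall v, B v -> v = 0
  | k.+1 => fun V B => exists (P : lmodType R) (f : {linear P -> V}),
      [/\ projective_module P, forall v, B v <-> exists u, f u = v &
          projres k (fun u => f u = 0)]
  end.

Lemma projres_of_projdim (V : lmodType R) k : projdim_le V k -> projres k.+1 (fun _ : V => True).
Proof.
move=> [P [D [eps [[projP exD exeps surj] hP]]]].
have main n i : (k <= i + n)%N -> projres n (fun u => exists w, D i w = u).
  elim: n i => [|n IH] i hi /=.
    by move=> _ [w <-]; rewrite (hP i.+1 _ w) ?linear0 // ltnS -[i]addn0.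
  exists (P i.+1), (D i); split=> //.
  have -> : (fun u => D i u = 0) = (fun u => exists w, D i.+1 w = u).
    by apply/funext => u; apply/propext; apply: exD.
  by apply: IH; rewrite addSnnS.
exists (P 0%N), eps; split=> //.
have -> : (fun u => eps u = 0) = (fun u => exists w, D 0%N w = u).
  by apply/funext => u; apply/propext; apply: exeps.
exact: main.
Qed.

Hypothesis noethR : noetherian R.
Variable m : R -> Prop.
Hypothesis primem : isprime m.
Hypothesis unit_notin : forall u, ~ m u -> exists v, v * u = 1.
Variables (h : nat) (x : nat -> R) (s : R).
Hypothesis ms : m s.
Hypothesis regx : forall i r, (i < h)%N -> idl x i (x i * r) -> idl x i r.

(** Krull's intersection theorem without powers: in a coordinate of a free module containing [P],
    the starting terms of all [s]-divisible sequences modulo (x) form an ideal [L], and L lies in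
    (x) + s L because a shifted sequence is again such a sequence. *)
Lemma divisible_projective (P : lmodType R) j (u : nat -> P) : projective_module P ->
  (forall k, inI x j (fun=> True) (s *: u k.+1 - u k)) -> inI x j (fun=> True) (u 0%N).
Proof.
move=> /projective_split [g hg] hu; rewrite -[u 0%N]hg.
apply: (inI_morph (B := fun=> True)) => //; apply/inI_coord => t.
have gu k : idl x j (s * (g (u k.+1))@_t - (g (u k))@_t).
  have := inI_morph (f := g) (B' := fun=> True) (fun _ _ => I) (hu k).
  by rewrite linearB linearZ /= => /inI_coord /(_ t); rewrite mcoeffB mcoeffZ.
have iI := ideal_idl x j.
pose L a := exists2 r : nat -> R, r 0%N = a & forall k, idl x j (s * r k.+1 - r k).
have : L (g (u 0%N))@_t by exists (fun k => (g (u k))@_t).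
move: (g (u 0%N))@_t; apply: (nakayama noethR primem unit_notin _ iI ms).
  apply: idealP.
  - by exists (fun=> 0) => // k; rewrite mulr0 subr0; apply: ideal0.
  - move=> _ _ [r <- hr] [r' <- hr']; exists (fun k => r k + r' k) => // k.
    by rewrite mulrDr opprD addrACA; apply: idealD.
  - move=> a _ [r <- hr]; exists (fun k => a * r k) => // k.
    by rewrite mulrCA -mulrBr; apply: idealM.
move=> _ [r <- hr]; exists (r 1%N); first by exists (fun k => r k.+1).
by rewrite -opprB; apply: idealN.
Qed.

(** Each connecting step spends one term of the resolution and gains one [x j], so [n + j] is
    constant. Running out of terms makes [B] zero; reaching [j = h] leaves a projective [B]. *)
Lemma no_divisible_socle n j (V : lmodType R) (B : V -> Prop) : projres n B ->
  (n + j <= h.+1)%N -> (j <= h)%N -> wreg x j B -> ~ divisible_socle x h s j B.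
Proof.
elim: n j V B => [|n IH] j V B.
  move=> hB _ _ _ [z [Bz _ nz _]]; apply: nz.
  have z0 := hB _ (Bz 0%N); rewrite z0; apply: submod0; apply: inI_submod.
  have B0 : B 0 by rewrite -z0.
  by split=> // a u v /hB -> /hB ->; rewrite scaler0 addr0.
move=> [P [f [projP imf resN]]]; rewrite leq_eqVlt => hn.
rewrite leq_eqVlt => /orP [/eqP ej|hj] regB.
  (* At [j = h] a single term remains, so [f] is injective and the tower lifts to [P]. *)
  have n0 : n = 0%N.
    by move: hn; rewrite -leq_eqVlt ej addSn ltnS -[X in (_ <= X)%N]add0n leq_add2r leqn0 => /eqP.
  rewrite n0 /= in resN; move=> [z [Bz sz nz _]].
  have [u hu] := choice (fun k => proj1 (imf (z k)) (Bz k)).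
  apply: nz; rewrite -hu; apply: (inI_morph (B := fun=> True)).
    by move=> w _; apply/imf; exists w.
  apply: divisible_projective => // k.
  have [|c hc ec] := inI_lift (q := f) (A := fun=> True) _ (sz k).
    by move=> w /imf [v <-]; exists v.
  suff <- : c = s *: u k.+1 - u k by [].
  apply/eqP; rewrite -subr_eq0; apply/eqP/resN.
  rewrite linearB /= [f (_ - u k)]linearB linearZ /= ec !hu; exact: subrr.
have regP : wreg x j.+1 (fun _ : P => True).
  by apply: (wreg_le hj); apply: wreg_projective.
move=> socB; apply: (IH j.+1 P (fun u => f u = 0) resN) => //.
- by rewrite addnS -addSn leq_eqVlt hn.
- exact: (wreg_ker imf (leqnn _) regB regP).
- exact: (connecting_step imf hj regB regP socB).
Qed.

End LowerBound.

(** * Divisibility in the injective envelope of R/p *)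

Section QuotientEnvelope.
Local Open Scope ring_scope.
Local Open Scope quotient_scope.
Variables (R : comNzRingType) (p : prime_idealr R) (E : lmodType R).

Lemma quot_eq0 (a : R) : (\pi_{ideal_quot p} a == 0) = (a \in p).
Proof. by rewrite -(rmorph0 \pi_{ideal_quot p}) -Quotient.idealrBE subr0. Qed.

Lemma repr_pi_sub (a : R) : repr (\pi_{ideal_quot p} a) - a \in p.
Proof. by rewrite -quot_eq0 rmorphB /= reprK subrr. Qed.

Lemma pi_scale (a b : R) : a *: \pi_{ideal_quot p} b = \pi_{ideal_quot p} (a * b).
Proof. by rewrite rmorphM. Qed.

Lemma scale_quot1 (r : R) : r \in p -> r *: (1 : {ideal_quot p}) = 0.
Proof.
by move=> hr; apply/eqP; rewrite -(rmorph1 \pi_{ideal_quot p}) pi_scale quot_eq0 mulr1.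
Qed.

(** The map from R/p to [E] sending 1 to [e] extends along multiplication by [s], injective on the
    domain R/p; the extension sends 1 to the wanted quotient, killed by [p] as 1 is. *)
Lemma injective_divide (s : R) (e : E) : s \notin p -> injective_module E ->
  (forall r, r \in p -> r *: e = 0) ->
  exists2 e', s *: e' = e & forall r, r \in p -> r *: e' = 0.
Proof.
move=> hs injE pe.
have pe2 a b : a - b \in p -> a *: e = b *: e.
  by move=> /pe /eqP; rewrite scalerBl subr_eq0 => /eqP.
have linf : linear (fun x : {ideal_quot p} => repr x *: e).
  move=> a x y; rewrite scalerA -scalerDl; apply: pe2.
  rewrite -quot_eq0 rmorphB rmorphD rmorphM /= !reprK.
  by apply/eqP; apply: subrr.
have linm : linear (fun x : {ideal_quot p} => s *: x).
  by move=> a x y; rewrite scalerDr !scalerA mulrC.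
pose f : {linear {ideal_quot p} -> E} :=
  HB.pack (fun x : {ideal_quot p} => repr x *: e) (GRing.isLinear.Build R _ _ _ _ linf).
pose mul : {linear {ideal_quot p} -> {ideal_quot p}} :=
  HB.pack (fun x : {ideal_quot p} => s *: x) (GRing.isLinear.Build R _ _ _ _ linm).
have injm : injective mul.
  move=> x y /eqP; rewrite -subr_eq0 -[_ - _]/(s *: x - s *: y) -scalerBr.
  rewrite -[x - y]reprK pi_scale quot_eq0 prime_idealrM (negPf hs) /= -quot_eq0 reprK subr_eq0.
  by move/eqP.
have [g hg] := injE _ _ mul f injm.
exists (g 1).
  transitivity (g (mul 1)); first by rewrite -linearZ.
  rewrite hg -[e in RHS]scale1r; apply: pe2.
  by rewrite -(rmorph1 \pi_{ideal_quot p}) repr_pi_sub.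
by move=> r hr; rewrite -linearZ /= scale_quot1 // linear0.
Qed.

Lemma divisible_torsion (s : R) : s \notin p -> is_injective_envelope {ideal_quot p} E ->
  exists e : nat -> E, [/\ e 0%N != 0, forall k, s *: e k.+1 = e k &
    forall k r, r \in p -> r *: e k = 0].
Proof.
move=> hs [injE [i [inji _]]].
pose S := {e : E | forall r, r \in p -> r *: e = 0}.
have next (e : S) : exists e' : S, s *: sval e' = sval e.
  have [e' h1 h2] := injective_divide hs injE (svalP e).
  by exists (exist _ e' h2).
have [nxt hnxt] := choice next.
have h0 r : r \in p -> r *: i 1 = 0.
  by move=> hr; rewrite -linearZ /= scale_quot1 // linear0.
exists (fun k => sval (iter k nxt (exist _ (i 1) h0))); split=> [|k|k].
- apply/eqP => /= e0; have := oner_neq0 {ideal_quot p}.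
  by rewrite -(inj_eq inji) e0 linear0 eqxx.
- exact: hnxt.
- exact: (svalP (iter k nxt _)).
Qed.

End QuotientEnvelope.

(** * Local rings, and passage from boolean ideals to predicates *)

Section LocalRings.
Local Open Scope ring_scope.
Variable R : comNzRingType.
Hypothesis noethR : noetherian R.
Variable m : idealr R.
Hypothesis localm : local_ring m.

Lemma local_unit u : u \notin m -> exists v, v * u = 1.
Proof.
move=> hu; apply: contrapT => hno.
pose F (I : R -> Prop) := [/\ ideal I, ~ I 1 & I u].
have hF I : F I -> ideal I by case.
have [|I [hI I1 Iu] hmax] := noeth_max noethR hF.
  exists (fun r => exists c, r = c * u); split; last by exists 1; rewrite mul1r.
    apply: idealP; first by exists 0; rewrite mul0r.
      by move=> _ _ [a ->] [b ->]; exists (a + b); rewrite mulrDl.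
    by move=> a _ [b ->]; exists (a * b); rewrite mulrA.
  by move=> [c hc]; apply: hno; exists c.
have [J hJ] := idealr_of hI I1.
have [_ /(_ J) hm] := localm.
have /hm e : maximal_ideal J.
  move=> J' hJJ' r hr; apply/hJ; apply: (hmax (fun x => x \in J')) => //.
    split; [exact: ideal_of_idealr | by rewrite idealr1 | by apply/hJJ'/hJ].
  by move=> x /hJ /hJJ'.
by move: hu; rewrite -e => /negP; apply; apply/hJ.
Qed.

Lemma local_prime : isprime (fun x => x \in m).
Proof.
split; [exact: ideal_of_idealr | by rewrite idealr1 |].
move=> u v huv; have [hu|/local_unit [w hw]] := boolP (u \in m); first by left.
by right; rewrite -[v]mul1r -hw -mulrA; apply: idealMr.
Qed.

Lemma local_unit_notin u : ~ u \in m -> exists v, v * u = 1.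
Proof. by move=> /negP; apply: local_unit. Qed.

Lemma idl_sum (y : nat -> R) d r :
  idl y d r <-> exists c : nat -> R, r = \sum_(i < d) c i * y i.
Proof.
elim: d r => [|d IH] r.
  by split=> [->|[c ->]]; [exists (fun=> 0) |]; rewrite big_ord0.
rewrite idlS; split=> [[b /IH [c hc]]|[c ->]].
  exists (fun i => if i == d then b else c i).
  rewrite big_ord_recr /= eqxx mulrC -[LHS](subrK (y d * b)) hc; congr (_ + _).
  by apply: eq_bigr => i _; rewrite ltn_eqF.
exists (c d); apply/IH; exists c.
by rewrite big_ord_recr /= [y d * _]mulrC addrK.
Qed.

Lemma pchain_of_prime_chain n (P : nat -> prime_idealr R) : prime_chain n P ->
  pchain n (fun i r => r \in P i).
Proof.
move=> hP; split=> i hi; first exact: isprime_of_prime_idealr.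
have [h1 h2] := hP i hi; split=> //.
apply: contrapT => hno; apply: h2 => x hx; apply: contrapT => hnx.
by apply: hno; exists x.
Qed.

End LocalRings.

Theorem corollary6p9 (R : comNzRingType) (m : idealr R) (d : nat)
    (p : prime_idealr R) (E : lmodType R) :
  regular_local_ring m d -> (0 < d)%N ->
  has_height p d.-1 ->
  ~ adic_complete (@quot_image R p m) ->
  is_injective_envelope {ideal_quot p} E ->
  has_projdim E d.
Proof.
move=> [noethR localm [[C hC] _] [g size_g gen_g]] d0 [[D hD eD] hmax] _ hE.
have primem := local_prime noethR localm.
have unit_notin := local_unit_notin noethR localm.
pose y i := nth (GRing.zero : R) g i.
have my r : r \in m <-> idl y d r.
  by rewrite gen_g size_g; split=> /idl_sum.
have dim_ge : exists P : nat -> R -> Prop, pchain d P.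
  by exists (fun i r => r \in C i); apply: pchain_of_prime_chain.
have regy := parameters_regular noethR primem unit_notin my dim_ge.
have primep := isprime_of_prime_idealr p.
have pm r : r \in p -> r \in m.
  by case: primep => ip p1 _; apply: (proper_sub unit_notin ip p1).
have [s [sm sp]] : exists s, s \in m /\ s \notin p.
  apply: contrapT => hno.
  have mp r : r \in m -> r \in p.
    by move=> hr; apply: contrapT => /negP hnr; apply: hno; exists r.
  (* If [p] were all of [m], a chain of length [d] with its top replaced by [p] would contradict the
     height [d.-1]. *)
  pose C' i := if (i < d)%N then C i else p.
  have hC' : prime_chain d C'.
    move=> i hi; have [h1 h2] := hC i hi; rewrite /C' hi.
    case: ltnP => // _; have Cm r : r \in C i.+1 -> r \in m.
      have [iC C1 _] := isprime_of_prime_idealr (C i.+1).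
      exact: (proper_sub unit_notin iC C1).
    split=> [r /h1/Cm/mp //|hpC]; apply: h2 => r /Cm/mp.
    exact: hpC.
  have : (d <= d.-1)%N by apply: (hmax d C' hC') => r; rewrite /C' ltnn.
  by rewrite -{1}(prednK d0) ltnn.
have adjacent Q : isprime Q -> (forall r, r \in p -> Q r) ->
    (exists2 a, Q a & ~ a \in p) -> forall r, r \in m -> Q r.
  apply: (primes_adjacent noethR primem unit_notin my (pchain_of_prime_chain hD)).
    by apply/funext => r; rewrite eD.
  by rewrite prednK.
have [|x px regx] := exists_regular noethR primem unit_notin d0 my regy primep adjacent (h := d.-1).
  by rewrite prednK.
split; first exact: (projdim_le_parameters noethR primem unit_notin my regy).
move=> k /projres_of_projdim resE; rewrite leqNgt; apply/negP => hk.
have [e [e0 se pe]] := divisible_torsion sp hE.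
(* At [j = 0] nothing is divided out: the tower lives in [E] itself, killed by the [x i] because
   they lie in [p]. *)
apply: (no_divisible_socle noethR primem unit_notin sm regx resE (j := 0)) => //.
  by rewrite addn0 prednK.
exists e; split=> //= [i||i j hj]; first by rewrite se subrr.
  exact/eqP.
by apply: pe; apply: px.
Qed.
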